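(* Fix $\xi_1,\xi_2$ and consider the deterministic tie-line scheduling problem of minimizing $J^*(y,\xi_1,\xi_2) = J_1^*(y,\xi_1)+J_2^*(y,\xi_2)$ over $y\in\mathcal{Y}$. There exists $\varepsilon_0>0$ such that for every step size $\varepsilon\in(0,\varepsilon_0)$, for every initial point $y\in\mathcal{Y}$ and every choice of critical regions returned by the system operators at points lying in more than one critical region, the critical region exploration algorithm (described in the context) terminates after finitely many steps, and the point $y^*$ held at termination is a minimizer of $J^*(\cdot,\xi_1,\xi_2)$ over $\mathcal{Y}$.
   Context: **Two-area power system model.** For $i=1,2$, area $i$ has $n_i$ internal buses and $\overline{n}_i$ boundary buses. Let $g_i,w_i,d_i,\theta_i\in\mathbf{R}^{n_i}$ (dispatchable generation, renewable generation, controllable load, phase angles at internal buses) and $\overline{\theta}_i\in\mathbf{R}^{\overline{n}_i}$ (phase angles at boundary buses). Write $x_i=(g_i,w_i,d_i,\theta_i)$, $\xi_i=(\overline{W}_i,\underline{D}_i,\overline{D}_i)\in\mathbf{R}^{3n_i}$, $y=(\overline{\theta}_1,\overline{\theta}_2)\in\mathbf{R}^{\overline{n}_1+\overline{n}_2}$. With given constant real matrices and vectors, the constraints of area $1$ are - power flow: $B_{11}\theta_1+B_{1\bar1}\overline{\theta}_1=g_1+w_1-d_1$ and $B_{\bar11}\theta_1+B_{\bar1\bar1}\overline{\theta}_1+B_{\bar1\bar2}\overline{\theta}_2=0$; - asset limits: $\underline{G}_1\le g_1\le\overline{G}_1$, $0\le w_1\le\overline{W}_1$, $\underline{D}_1\le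 d_1\le\overline{D}_1$ (elementwise); - line limits: $H_1\theta_1+\overline{H}_1\overline{\theta}_1\le f_1$; and symmetrically for area $2$ (indices $1$ and $2$ swapped). These are written jointly (equalities as pairs of inequalities) as a system of $m_i$ linear inequalities $A_i^x x_i+A_i^\xi\xi_i+A_i^y y\le b_i$. The tie-line constraints $\overline{H}_{12}\overline{\theta}_1+\overline{H}_{21}\overline{\theta}_2\le f_{12}$ (together with the slack-bus convention that the phase angle of one designated boundary bus in area 1 is zero, and bounds on phase angles) are written $y\in\mathcal{Y}$, where $\mathcal{Y}$ is a nonempty polytope in $\mathbf{R}^{\overline{n}_1+\overline{n}_2}$. The dispatch cost of area $i$ is $$[P_i^g]^\top g_i+[P_i^w]^\top(\overline{W}_i-w_i)+[P_i^d]^\top(\overline{D}_i-d_i)=:c_i(x_i,\xi_i)=c_i^0+[c_i^x]^\top x_i+[c_i^\xi]^\top\xi_i .$$ Define $J_i^*(y,\xi_i):=\min_{x_i}\{c_i(x_i,\xi_i): A_i^x x_i+A_i^\xi\xi_i+A_i^y y\le b_i\}$. Standing assumption: this linear program is feasible for each $y\in\mathcal{Y}$. **Critical regions.** A finite collection of polytopes is a polyhedral partition of $\mathcal{Y}$ if no two of them intersect except at their boundaries and their union is $\mathcal{Y}$. For fixed $\xi_i$, the function $J_i^*(\cdot,\xi_i)$ is convex and piecewise affine on $\mathcal{Y}$; fix a polyhedral partition of $\mathcal{Y}$ into polytopes (each of the same dimension as $\mathcal{Y}$) on each of which $J_i^*(\cdot,\xi_i)$ is affine, with a fixed affine description on each.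 These polytopes are the critical regions induced by $J_i^*(\cdot,\xi_i)$. For $y\in\mathcal{Y}$, system operator $i$ returns a critical region $\mathcal{P}_i^y$ containing $y$ (if there are several, an arbitrary one of them) and its affine description: $J_i^*(z,\xi_i)=[\alpha_i^y]^\top z+\beta_i^y$ for $z\in\mathcal{P}_i^y$. Put $\mathcal{P}^y=\mathcal{P}_1^y\cap\mathcal{P}_2^y$, $\alpha^y=\alpha_1^y+\alpha_2^y$, $\beta^y=\beta_1^y+\beta_2^y$. $N_{\mathcal{Y}}(y^* )$ is the normal cone to $\mathcal{Y}$ at $y^*$, $\mathrm{conv}$ denotes convex hull, and sums of sets are Minkowski sums. A vector $a$ is lexicographically smaller than $b$ if at the first index where they differ the entry of $a$ is less than that of $b$. **Critical region exploration algorithm** (step size $\varepsilon>0$). Initialize: $y$ any point in $\mathcal{Y}$, $J^*\gets\infty$ (here $J^*$ is a scalar variable), $\mathcal{D}\gets\emptyset$. Repeat: 1. Obtain $\mathcal{P}^y,\alpha^y,\beta^y$. 2. Minimize $[\alpha^y]^\top z+\beta^y$ over $z\in\mathcal{P}^y$; let $y^{\mathrm{opt}}$ be the lexicographically smallest minimizer and $J^{\mathrm{opt}}$ the optimal value. 3. If $J^{\mathrm{opt}}<J^*$, set $y^*\gets y^{\mathrm{opt}}$, $J^*\gets J^{\mathrm{opt}}$, $\mathcal{D}\gets\{\alpha^y\}$; otherwise set $\mathcal{D}\gets\mathcal{D}\cup\{\alpha^y\}$. 4. Let $v^*$ be the minimum-Euclidean-norm element of $\mathrm{conv}(\mathcal{D})+N_{\mathcal{Y}}(y^*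 )$. 5. Set $y\gets y^*-\varepsilon v^*$. Continue while $v^*\ne0$; terminate when $v^*=0$. *)

(* Defs.v *)
From mathcomp Require Import all_boot all_order all_algebra.
From mathcomp Require Import all_classical all_reals.
From mathcomp Require Import ereal topology normedtype convex.

Set Implicit Arguments.
Unset Strict Implicit.
Unset Printing Implicit Defensive.

Import Order.TTheory GRing.Theory Num.Theory.
Import numFieldNormedType.Exports.

Local Open Scope classical_set_scope.
Local Open Scope ring_scope.

Section Vectors.
Variables (R : realType) (n : nat).
Implicit Types (u v x z : 'cV[R]_n) (S C : set 'cV[R]_n).

Definition vle u v : Prop := forall i, u i 0 <= v i 0.

Definition dot u v : R := (u^T *m v) 0 0.

(* The library norm on matrices is the sup norm. *)
Definition enorm u : R := Num.sqrt (dot u u).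

Definition lex_lt u v : Prop :=
  exists i : 'I_n, (forall j : 'I_n, (j < i)%N -> u j 0 = v j 0) /\
    u i 0 < v i 0.

Definition polytope S : Prop :=
  (exists (m : nat) (A : 'M[R]_(m, n)) (b : 'cV[R]_m),
     S = [set z | forall i, (A *m z) i 0 <= b i 0]) /\
  (exists M : R, forall z, S z -> enorm z <= M).

Definition affine_hull S : set 'cV[R]_n :=
  [set x | exists (k : nat) (p : 'I_k -> 'cV[R]_n) (w : 'I_k -> R),
     [/\ forall i, S (p i), \sum_i w i = 1 & x = \sum_i w i *: p i]].

(* The topology of 'cV[R]_n is the usual one of R^n. *)
Definition rel_interior S : set 'cV[R]_n :=
  [set x | S x /\ exists2 U, nbhs x U & U `&` affine_hull S `<=` S].

Definition rel_boundary S : set 'cV[R]_n := closure S `\` rel_interior S.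

Definition affinely_independent (k : nat) (p : 'I_k -> 'cV[R]_n) : Prop :=
  forall w : 'I_k -> R,
    \sum_i w i = 0 -> \sum_i w i *: p i = 0 -> forall i, w i = 0.

(* One less than the largest number of affinely independent points of S
   (at most n + 1); the empty set has dimension -1. *)
Definition affine_dim S : int :=
  (\max_(k < n.+2 | `[< exists p : 'I_k -> 'cV[R]_n,
      (forall i, S (p i)) /\ affinely_independent p >]) (k : nat))%N%:Z - 1.

Definition convex_hull S : set 'cV[R]_n :=
  smallest (@convex_set R 'cV[R]_n) S.

Definition normal_cone C x : set 'cV[R]_n :=
  [set u | forall z, C z -> dot u (z - x) <= 0].

Definition minkowski_sum S C : set 'cV[R]_n :=
  [set u + v | u in S & v in C].

Definition minimizer (f : 'cV[R]_n -> R) S z : Prop :=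
  S z /\ forall z', S z' -> f z <= f z'.

Definition lex_minimizer (f : 'cV[R]_n -> R) S z : Prop :=
  minimizer f S z /\
  forall z', minimizer f S z' -> z' <> z -> lex_lt z z'.

End Vectors.

(* The minimum of a set of reals; 0 if there is none. *)
Definition minimum (R : realType) (S : set R) : R := xget 0 (S `&` lbound S).

(* n internal buses, nb own boundary buses, nbo boundary buses of the other
   area, l internal lines. In B_xy (and H_x), i stands for internal, b for own
   boundary and o for other boundary. *)
Record area (R : realType) (n nb nbo l : nat) := Area {
  B_ii : 'M[R]_(n, n);
  B_ib : 'M[R]_(n, nb);
  B_bi : 'M[R]_(nb, n);
  B_bb : 'M[R]_(nb, nb);
  B_bo : 'M[R]_(nb, nbo);
  G_min : 'cV[R]_n;
  G_max : 'cV[R]_n;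
  H_i : 'M[R]_(l, n);
  H_b : 'M[R]_(l, nb);
  f_max : 'cV[R]_l;
  P_g : 'cV[R]_n;
  P_w : 'cV[R]_n;
  P_d : 'cV[R]_n
}.

(* xi = (W_max, D_min, D_max) *)
Record scenario (R : realType) (n : nat) := Scenario {
  W_max : 'cV[R]_n;
  D_min : 'cV[R]_n;
  D_max : 'cV[R]_n
}.

(* x = (g, w, d, theta) *)
Record dispatch (R : realType) (n : nat) := Dispatch {
  gen : 'cV[R]_n;
  wind : 'cV[R]_n;
  load : 'cV[R]_n;
  theta : 'cV[R]_n
}.

Section AreaProblem.
Variables (R : realType) (n nb nbo l : nat).
Variables (a : area R n nb nbo l) (xi : scenario R n).

Definition feasible (own : 'cV[R]_nb) (other : 'cV[R]_nbo) :
    set (dispatch R n) :=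
  [set x |
    [/\ B_ii a *m theta x + B_ib a *m own = gen x + wind x - load x,
        B_bi a *m theta x + B_bb a *m own + B_bo a *m other = 0,
        [/\ vle (G_min a) (gen x) /\ vle (gen x) (G_max a),
            vle 0 (wind x) /\ vle (wind x) (W_max xi) &
            vle (D_min xi) (load x) /\ vle (load x) (D_max xi)] &
        vle (H_i a *m theta x + H_b a *m own) (f_max a)]].

Definition cost (x : dispatch R n) : R :=
  dot (P_g a) (gen x) + dot (P_w a) (W_max xi - wind x) +
  dot (P_d a) (D_max xi - load x).

Definition opt_cost (own : 'cV[R]_nb) (other : 'cV[R]_nbo) : R :=
  minimum (cost @` feasible own other).

End AreaProblem.

(* slack is the boundary bus of area 1 with zero phase angle. *)
Record tieline (R : realType) (nb1 nb2 l12 : nat) := Tieline {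
  H_12 : 'M[R]_(l12, nb1);
  H_21 : 'M[R]_(l12, nb2);
  f_12 : 'cV[R]_l12;
  slack : 'I_nb1;
  y_min : 'cV[R]_(nb1 + nb2);
  y_max : 'cV[R]_(nb1 + nb2)
}.

(* y = col_mx theta1 theta2 stacks the boundary phase angles of both areas. *)
Section Interface.
Variables (R : realType) (n1 n2 nb1 nb2 l1 l2 l12 : nat).
Implicit Types y : 'cV[R]_(nb1 + nb2).

Definition Yset (t : tieline R nb1 nb2 l12) : set 'cV[R]_(nb1 + nb2) :=
  [set y | [/\ vle (H_12 t *m usubmx y + H_21 t *m dsubmx y) (f_12 t),
               usubmx y (slack t) 0 = 0,
               vle (y_min t) y & vle y (y_max t)]].

Definition feasible1 (a1 : area R n1 nb1 nb2 l1) (xi1 : scenario R n1) y :=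
  feasible a1 xi1 (usubmx y) (dsubmx y).

Definition feasible2 (a2 : area R n2 nb2 nb1 l2) (xi2 : scenario R n2) y :=
  feasible a2 xi2 (dsubmx y) (usubmx y).

Definition J1 (a1 : area R n1 nb1 nb2 l1) (xi1 : scenario R n1) y : R :=
  opt_cost a1 xi1 (usubmx y) (dsubmx y).

Definition J2 (a2 : area R n2 nb2 nb1 l2) (xi2 : scenario R n2) y : R :=
  opt_cost a2 xi2 (dsubmx y) (usubmx y).

End Interface.

Record regions (R : realType) (N : nat) := Regions {
  nreg : nat;
  region : 'I_nreg -> set 'cV[R]_N;
  slope : 'I_nreg -> 'cV[R]_N;
  intercept : 'I_nreg -> R
}.

(* Boundaries are relative to the affine hull: Y lies in the hyperplane where
   the slack angle vanishes, so every subset of Y has empty interior. *)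
Definition polyhedral_partition (R : realType) (N k : nat)
    (Y : set 'cV[R]_N) (P : 'I_k -> set 'cV[R]_N) : Prop :=
  [/\ forall r, polytope (P r),
      forall r s, r <> s ->
        P r `&` P s `<=` rel_boundary (P r) `&` rel_boundary (P s) &
      \bigcup_r P r = Y].

Definition critical_regions (R : realType) (N : nat) (Y : set 'cV[R]_N)
    (J : 'cV[R]_N -> R) (c : regions R N) : Prop :=
  [/\ polyhedral_partition Y (@region R N c),
      forall r, affine_dim (@region R N c r) = affine_dim Y &
      forall r z, @region R N c r z -> J z = dot (slope r) z + intercept r].

Section Algorithm.
Variables (R : realType) (N : nat).
Variables (Y : set 'cV[R]_N) (c1 c2 : regions R N) (eps : R).

(* Values of (y, y^*, J^*, D) at the beginning of an iteration. *)
Record state := State {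
  query : 'cV[R]_N;
  incumbent : 'cV[R]_N;
  value : \bar R;
  cuts : set 'cV[R]_N
}.

(* One pass through the loop body from s to s', in which the operators return
   the regions r1 and r2 and the minimum-norm element is v. *)
Definition iteration (r1 : 'I_(nreg c1)) (r2 : 'I_(nreg c2)) (v : 'cV[R]_N)
    (s s' : state) : Prop :=
  let P := region r1 `&` region r2 in
  let alpha := slope r1 + slope r2 in
  let beta := intercept r1 + intercept r2 in
  [/\ P (query s),
      exists2 yopt, lex_minimizer (fun z => dot alpha z + beta) P yopt &
        let Jopt := (dot alpha yopt + beta)%:E in
        if (Jopt < value s)%E
        then [/\ incumbent s' = yopt, value s' = Jopt &
                 cuts s' = [set alpha]]
        else [/\ incumbent s' = incumbent s, value s' = value s &
                 cuts s' = cuts s `|` [set alpha]],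
      minimizer (@enorm R N)
        (minkowski_sum (convex_hull (cuts s')) (normal_cone Y (incumbent s')))
        v &
      query s' = incumbent s' - eps *: v].

(* The initial value of y^* is unspecified. *)
Definition initial (y0 : 'cV[R]_N) (s : state) : Prop :=
  [/\ query s = y0, value s = +oo%E & cuts s = set0].

(* States at the beginning of an iteration that is actually performed. *)
Inductive reachable (y0 : 'cV[R]_N) : state -> Prop :=
| reachable_initial s : initial y0 s -> reachable y0 s
| reachable_next s r1 r2 v s' :
    reachable y0 s -> iteration r1 r2 v s s' -> v <> 0 -> reachable y0 s'.

(* No step of the algorithm is undefined: whatever regions are returned, the
   iteration can be carried out. *)
Definition never_stuck (y0 : 'cV[R]_N) : Prop :=
  forall s, reachable y0 s -> Y (query s) /\
    forall r1 r2, region r1 (query s) -> region r2 (query s) ->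
      exists v s', @iteration r1 r2 v s s'.

Definition no_infinite_execution (y0 : 'cV[R]_N) : Prop :=
  ~ exists (s : nat -> state) (r1 : nat -> 'I_(nreg c1))
           (r2 : nat -> 'I_(nreg c2)) (v : nat -> 'cV[R]_N),
      initial y0 (s 0%N) /\
      forall k, iteration (r1 k) (r2 k) (v k) (s k) (s k.+1) /\ v k <> 0.

(* y is the value of y^* when some execution terminates. *)
Definition output (y0 y : 'cV[R]_N) : Prop :=
  exists s r1 r2 s',
    [/\ reachable y0 s, @iteration r1 r2 0 s s' & y = incumbent s'].

End Algorithm.

(* Main.v *)
(* Each J_i is convex, being the value of a linear program, and a critical region
   has the dimension of Y, so the affine description of J on any region is a
   minorant of J on all of Y, exact on that region. Hence every cut is a
   subgradient at the incumbent y*, and v* = 0 means that y* is optimal.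

   The points y* and v* take finitely many values, and - v* is a feasible direction of
   the polyhedron Y at y*. So for eps small, uniformly, y* - eps v* stays in Y and
   only belongs to regions that already contain y*. If the regions met there do not
   improve on the incumbent, their slope alpha satisfies <alpha, v*> <= 0, whereas
   <d, v*> >= |v*|^2 > 0 for every previous cut d: the cut is new. Each iteration thus
   either lowers the incumbent value, which is the optimum over one of finitely many
   pairs of regions, or adds one of finitely many slopes. *)
Require Import Defs.
From mathcomp Require Import all_boot all_order all_algebra.
From mathcomp Require Import all_classical all_reals.
From mathcomp Require Import ereal topology normedtype derive convex.
From mathcomp Require Import interval_inference.
From mathcomp Require Import ring lra zify.

Import Order.TTheory GRing.Theory Num.Theory.
Import numFieldNormedType.Exports.
Local Open Scope classical_set_scope.
Local Open Scope ring_scope.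

(** * Affine maps and linear programs *)

(** One identity along lines, so that closure under sums, compositions and pairings is plain
    rewriting in any module. The linear part is recovered in [affine_functional]. *)
Definition affine_map {R : realFieldType} {V W : lmodType R} (f : V -> W) : Prop :=
  forall t x y, f (x + t *: (y - x)) = f x + t *: (f y - f x).

Lemma affine_linear (R : realFieldType) (V W : lmodType R) (f : {linear V -> W}) :
  affine_map f.
Proof. by move=> t x y; rewrite linearD linearZ linearB. Qed.

Lemma affine_cst (R : realFieldType) (V W : lmodType R) (c : W) :
  affine_map (fun _ : V => c).
Proof. by move=> t x y; rewrite subrr scaler0 addr0. Qed.

Lemma affine_add (R : realFieldType) (V W : lmodType R) (f g : V -> W) :
  affine_map f -> affine_map g -> affine_map (fun x => f x + g x).
Proof.
move=> af ag t x y; rewrite af ag addrACA -scalerDr; congr (_ + _ *: _).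
by rewrite opprD addrACA.
Qed.

Lemma affine_opp (R : realFieldType) (V W : lmodType R) (f : V -> W) :
  affine_map f -> affine_map (fun x => - f x).
Proof. by move=> af t x y; rewrite af opprD -scalerN opprD. Qed.

Lemma affine_sub (R : realFieldType) (V W : lmodType R) (f g : V -> W) :
  affine_map f -> affine_map g -> affine_map (fun x => f x - g x).
Proof. by move=> af ag; apply/affine_add/affine_opp. Qed.

Lemma affine_comp (R : realFieldType) (U V W : lmodType R)
    (g : V -> W) (f : U -> V) :
  affine_map g -> affine_map f -> affine_map (fun x => g (f x)).
Proof. by move=> ag af t x y; rewrite af ag. Qed.

Definition polyhedron {R : realFieldType} {V : lmodType R} (S : set V) : Prop :=
  exists (I : finType) (l : I -> V -> R^o),
    (forall i, affine_map (l i)) /\ S = [set x | forall i, l i x <= 0].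

Section LinearProgram.
Context {R : realFieldType} {V : lmodType R} {I : finType}.
Variables (l : I -> V -> R^o) (f : V -> R^o).
Hypotheses (affl : forall i, affine_map (l i)) (afff : affine_map f).
Let S : set V := [set x | forall i, l i x <= 0].
Let active x : {set I} := [set i | l i x == 0]%SET.
(** Here [z] need not be feasible: [x] is optimal on the whole affine subspace cut out by its active
    constraints. Hence two terminal points with the same active set have the same value of [f]. *)
Let terminal x := forall z, (forall i, i \in active x -> l i z = 0) -> f x <= f z.

(* Moving from a feasible point along the face of its active constraints, in a
   direction that decreases f, activates a new constraint. *)
Lemma descend_to_terminal (M : R) x : (forall z, S z -> M <= f z) -> S x ->
  exists x', [/\ S x', terminal x' & f x' <= f x].
Proof.
move=> fM; have [k] := ubnP #|~: active x|; elim: k x => // k IH x ltk Sx.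
have [tx|ntx] := pselect (terminal x); first by exists x; split.
have [z zact zlt] : exists2 z, forall i, i \in active x -> l i z = 0 & f z < f x.
  apply: contrapT => no; apply: ntx => z hz; rewrite leNgt; apply/negP => zlt.
  by apply: no; exists z.
pose p t := x + t *: (z - x).
have lp i t : l i (p t) = l i x + t * (l i z - l i x) by exact: affl.
have fp t : f (p t) = f x + t * (f z - f x) by exact: afff.
(* If no constraint increases towards [z], the whole ray is feasible, and the [t] below brings [f]
   down to [M - 1], against the lower bound [M]. *)
have [[i0 i0P]|noB] := pselect (exists i, 0 < l i z - l i x); last first.
  pose t := (f x - M + 1) / (f x - f z).
  have d0 : 0 < f x - f z by rewrite subr_gt0.
  have t0 : 0 <= t by rewrite divr_ge0 ?ltW// ltr_pwDr// subr_ge0 fM.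
  have Sp : S (p t).
    move=> i; rewrite lp; have := Sx i; suff : t * (l i z - l i x) <= 0 by lra.
    rewrite mulr_ge0_le0// leNgt; apply/negP => li0; apply: noB.
    by exists i.
  have := fM _ Sp; rewrite fp -[f z - f x]opprB mulrN /t divfK ?gt_eqF//.
  by move=> h; exfalso; lra.
(* Ratio test: [q i] is the parameter at which an increasing constraint becomes tight; the smallest
   one is the longest feasible move. *)
pose q i := - l i x / (l i z - l i x).
case: (@Order.TotalTheory.arg_minP _ _ _ i0 (fun i => 0 < l i z - l i x) q i0P).
move=> j jP jmin.
have q0 i : 0 < l i z - l i x -> 0 <= q i.
  by move=> h; apply: divr_ge0; [rewrite oppr_ge0; exact: Sx|exact: ltW].
have Sp : S (p (q j)).
  move=> i; rewrite lp; have [h|h] := ltP 0 (l i z - l i x).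
    have := jmin _ h; rewrite -(ler_pM2r h) /q [X in _ <= X]divfK ?gt_eqF//.
    by rewrite -/(q j); lra.
  by have := Sx i; have := mulr_ge0_le0 (q0 _ jP) h; lra.
have fle : f (p (q j)) <= f x.
  rewrite fp; have := mulr_ge0_le0 (q0 _ jP) (_ : f z - f x <= 0).
  by move=> /(_ (ltac:(lra))); lra.
have sub : ~: active (p (q j)) \proper ~: active x.
  apply/properP; split.
    apply/fintype.subsetP => i; rewrite !inE; apply: contraNN => /eqP li0.
    by rewrite lp zact ?inE ?li0// subrr mulr0 addr0.
  exists j; rewrite !inE.
    apply/eqP => lj0; move: jP; rewrite zact ?inE ?lj0//.
    by rewrite subrr ltxx.
  by rewrite negbK lp /q divfK ?addrN// gt_eqF.
have [|x' [Sx' tx' lex']] := IH (p (q j)) _ Sp.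
  by rewrite (leq_trans (proper_card sub)).
by exists x'; split=> //; exact: le_trans lex' fle.
Qed.

(** Every feasible point is dominated by a terminal one, and the value at a terminal point depends
    only on its active set. It therefore suffices to minimize over the finitely many active sets
    that occur. *)
Lemma linear_program_attained (M : R) : (forall z, S z -> M <= f z) -> S !=set0 ->
  exists2 x, S x & forall z, S z -> f x <= f z.
Proof.
move=> fM [x0 Sx0].
pose T (A : {set I}) := [set x | [/\ S x, terminal x & active x = A]].
have Tf A x y : T A x -> T A y -> f x <= f y.
  by move=> [_ tx ax] [_ _ ay]; apply: tx => i; rewrite ax -ay inE => /eqP.
have [x1 [Sx1 tx1 _]] := descend_to_terminal M x0 fM Sx0.
pose P A := `[< T A !=set0 >].
have P1 : P (active x1) by apply/asboolP; exists x1; split.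
pose g A : R := f (xget x0 (T A)).
case: (@Order.TotalTheory.arg_minP _ _ _ _ P g P1) => A /asboolP TA0 Amin.
have TA := xgetPex x0 TA0.
exists (xget x0 (T A)); first by case: TA.
move=> z Sz; have [z' [Sz' tz' lez']] := descend_to_terminal M z fM Sz.
apply: le_trans lez'; have Tz' : T (active z') z' by split.
have Pz' : P (active z') by apply/asboolP; exists z'.
apply: le_trans (Amin _ Pz') _.
by apply: Tf Tz'; apply: xgetPex; exists z'.
Qed.

End LinearProgram.

(** * Operations on polyhedra *)

Section Polyhedra.
Context {R : realFieldType} {V : lmodType R}.
Implicit Types S : set V.

Lemma polyhedron_attained S (f : V -> R^o) (M : R) :
  polyhedron S -> affine_map f -> (forall z, S z -> M <= f z) -> S !=set0 ->
  exists2 x, S x & forall z, S z -> f x <= f z.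
Proof.
move=> [I [l [affl ->]]] afff fM S0.
exact: (linear_program_attained l f affl afff M).
Qed.

Lemma polyhedronI S1 S2 : polyhedron S1 -> polyhedron S2 -> polyhedron (S1 `&` S2).
Proof.
move=> [I1 [l1 [a1 ->]]] [I2 [l2 [a2 ->]]].
exists (I1 + I2)%type, (fun i => match i with inl i => l1 i | inr i => l2 i end).
split=> [[]//|]; apply/seteqP; split=> [x [h1 h2] []//|x h].
by split=> i; [exact: (h (inl i))|exact: (h (inr i))].
Qed.

Lemma polyhedron_le (f g : V -> R^o) :
  affine_map f -> affine_map g -> polyhedron [set x | f x <= g x].
Proof.
move=> af ag; exists unit, (fun _ x => f x - g x); split=> [_|].
  exact: affine_sub.
by apply/seteqP; split=> x /=; [move=> h _|move=> /(_ tt)]; rewrite ?subr_le0.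
Qed.

Lemma polyhedron_eq (f g : V -> R^o) :
  affine_map f -> affine_map g -> polyhedron [set x | f x = g x].
Proof.
move=> af ag; rewrite (_ : mkset _ = [set x | f x <= g x] `&` [set x | g x <= f x]).
  by apply: polyhedronI; exact: polyhedron_le.
apply/seteqP; split=> x /=; first by move=> ->.
by move=> [h1 h2]; apply/eqP; rewrite eq_le h1 h2.
Qed.

Lemma polyhedron_forall (I : finType) (S : I -> set V) :
  (forall i, polyhedron (S i)) -> polyhedron [set x | forall i, S i x].
Proof.
move=> pS; pose J i := projT1 (cid (pS i)).
pose cl i := cid (projT2 (cid (pS i))); pose l i : J i -> V -> R^o := projT1 (cl i).
have hl i : (forall j, affine_map (l i j)) /\ S i = [set x | forall j, l i j x <= 0].
  exact: projT2 (cl i).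
exists {i : I & J i}, (fun k => l (tag k) (tagged k)); split=> [k|].
  by case: (hl (tag k)).
apply/seteqP; split=> [x h k|x h i].
  by have := h (tag k); case: (hl (tag k)) => _ ->; exact.
by case: (hl i) => _ -> j; exact: (h (Tagged J j)).
Qed.

Lemma polyhedron_cvx S t x y : polyhedron S -> S x -> S y -> 0 <= t <= 1 ->
  S (x + t *: (y - x)).
Proof.
move=> [I [l [affl ->]]] Sx Sy /andP[t0 t1] i; rewrite affl.
have := Sx i; have := Sy i; rewrite /GRing.scale/= => ly lx.
have := mulr_ge0_le0 t0 ly; have : (1 - t) * l i x <= 0.
  by rewrite mulr_ge0_le0// subr_ge0.
by lra.
Qed.

End Polyhedra.

Section PolyhedronMatrices.
Context {R : realFieldType} {V : lmodType R} {m : nat}.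
Implicit Types f g : V -> 'cV[R]_m.

Lemma polyhedron_preimage (W : lmodType R) (g : V -> W) (S : set W) :
  affine_map g -> polyhedron S -> polyhedron (g @^-1` S).
Proof.
move=> ag [I [l [al ->]]]; exists I, (fun i x => l i (g x)); split=> // i.
exact: affine_comp.
Qed.

Lemma affine_mulmx p (A : 'M[R]_(p, m)) f :
  affine_map f -> affine_map (fun x => A *m f x).
Proof. by move=> af; apply: affine_comp af; exact: (affine_linear _ _ _ (mulmx A)). Qed.

Lemma affine_coord f i : affine_map f -> affine_map (fun x => f x i 0 : R^o).
Proof. by move=> af t x y; rewrite af !mxE. Qed.

Lemma polyhedron_coord_le f g : affine_map f -> affine_map g ->
  polyhedron [set x | forall i, f x i 0 <= g x i 0].
Proof.
by move=> af ag; apply: polyhedron_forall => i; apply: polyhedron_le;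
  exact: affine_coord.
Qed.

Lemma polyhedron_mx_eq f g : affine_map f -> affine_map g ->
  polyhedron [set x | f x = g x].
Proof.
move=> af ag.
rewrite (_ : mkset _ = [set x | forall i, f x i 0 = g x i 0]).
  by apply: polyhedron_forall => i; apply: polyhedron_eq; exact: affine_coord.
apply/seteqP; split=> x /= h; first by rewrite h.
by apply/matrixP => i j; rewrite (ord1 j).
Qed.

End PolyhedronMatrices.

(** * Inner product and affine functionals *)

Section DotProduct.
Context {R : realType} {n : nat}.
Implicit Types u v w : 'cV[R]_n.

Lemma dotE u v : dot u v = \sum_i u i 0 * v i 0.
Proof. by rewrite /dot mxE; apply: eq_bigr => i _; rewrite mxE. Qed.

Lemma dotC u v : dot u v = dot v u.
Proof. by rewrite !dotE; apply: eq_bigr => i _; rewrite mulrC. Qed.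

Lemma dotDr u v w : dot u (v + w) = dot u v + dot u w.
Proof. by rewrite /dot mulmxDr mxE. Qed.

Lemma dotNr u v : dot u (- v) = - dot u v.
Proof. by rewrite /dot mulmxN mxE. Qed.

Lemma dotBr u v w : dot u (v - w) = dot u v - dot u w.
Proof. by rewrite dotDr dotNr. Qed.

Lemma dotZr a u v : dot u (a *: v) = a * dot u v.
Proof. by rewrite /dot -scalemxAr mxE. Qed.

Lemma dotDl u v w : dot (v + w) u = dot v u + dot w u.
Proof. by rewrite !(dotC _ u) dotDr. Qed.

Lemma dotNl u v : dot (- v) u = - dot v u.
Proof. by rewrite !(dotC _ u) dotNr. Qed.

Lemma dotBl u v w : dot (v - w) u = dot v u - dot w u.
Proof. by rewrite !(dotC _ u) dotBr. Qed.

Lemma dotZl a u v : dot (a *: v) u = a * dot v u.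
Proof. by rewrite !(dotC _ u) dotZr. Qed.

Lemma dot0l u : dot 0 u = 0.
Proof. by rewrite -(scale0r u) dotZl mul0r. Qed.

Lemma dot_ge0 u : 0 <= dot u u.
Proof. by rewrite dotE sumr_ge0// => i _; rewrite -expr2 sqr_ge0. Qed.

Lemma dot_eq0 u : dot u u <= 0 -> u = 0.
Proof.
move=> u0; have /eqP : dot u u = 0 by apply/eqP; rewrite eq_le u0 dot_ge0.
rewrite dotE psumr_eq0 => [/allP h|i _]; last by rewrite -expr2 sqr_ge0.
apply/matrixP => i j; rewrite (ord1 j) mxE; apply/eqP.
by have := h i (mem_index_enum _); rewrite /= mulf_eq0 orbb.
Qed.

Lemma enorm_le u v : (enorm u <= enorm v) = (dot u u <= dot v v).
Proof. by rewrite ler_sqrt// dot_ge0. Qed.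

Lemma coord_le_enorm u i : `|u i 0| <= enorm u.
Proof.
rewrite -sqrtr_sqr ler_sqrt ?dot_ge0// dotE (bigD1 i)//= -expr2 lerDl.
by apply: sumr_ge0 => j _; rewrite -expr2 sqr_ge0.
Qed.

Lemma affine_dot (V : lmodType R) u (f : V -> 'cV[R]_n) :
  affine_map f -> affine_map (fun x => dot u (f x) : R^o).
Proof. by move=> af t x y; rewrite af dotDr dotZr dotBr. Qed.

Lemma dot_lower_bound u lo hi : exists M : R,
  forall z, vle lo z -> vle z hi -> M <= dot u z.
Proof.
exists (\sum_i Num.min (u i 0 * lo i 0) (u i 0 * hi i 0)) => z loz zhi.
rewrite dotE; apply: ler_sum => i _; rewrite ge_min.
have [u0|u0] := leP 0 (u i 0); first by apply/orP; left; apply: ler_wpM2l.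
by apply/orP; right; apply: ler_wnM2l => //; exact: ltW.
Qed.

(** The vector [a] is the gradient of [l]; its coordinates are the increments of [l] along the
    standard basis. *)
Lemma affine_functional (l : 'cV[R]_n -> R^o) : affine_map l ->
  exists a, forall y z, l z - l y = dot a (z - y).
Proof.
move=> al; pose h z : R := l z - l 0.
have hZ t z : h (t *: z) = t * h z.
  by have := al t 0 z; rewrite add0r subr0 /h => ->; rewrite addrC addKr.
have hD y z : h (y + z) = h y + h z.
  (* Additivity comes from affinity at the midpoint, [t = 1/2], and homogeneity with factor 2. *)
  have -> : y + z = 2 *: (y + 2^-1 *: (z - y)).
    by apply/matrixP => i j; rewrite !mxE; field.
  rewrite hZ /h al /GRing.scale/=. lra.
pose a := \col_i h (delta_mx i 0); exists a => y z.
have hdot x : h x = dot a x.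
  rewrite dotE {1}(matrix_sum_delta x) (big_morph h hD (_ : h 0 = 0)).
    by apply: eq_bigr => i _; rewrite big_ord1 hZ mxE mulrC.
  by rewrite /h subrr.
by rewrite dotBr -!hdot /h; ring.
Qed.

End DotProduct.

Lemma affine_fst (R : realFieldType) (U V W : lmodType R) (f : U -> V * W) :
  affine_map f -> affine_map (fun x => (f x).1).
Proof. by move=> af t x y; rewrite af. Qed.

Lemma affine_snd (R : realFieldType) (U V W : lmodType R) (f : U -> V * W) :
  affine_map f -> affine_map (fun x => (f x).2).
Proof. by move=> af t x y; rewrite af. Qed.

Lemma affine_id (R : realFieldType) (V : lmodType R) : affine_map (@id V).
Proof. by []. Qed.

Lemma affine_pair (R : realFieldType) (U V W : lmodType R) (f : U -> V) (g : U -> W) :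
  affine_map f -> affine_map g -> affine_map (fun x => (f x, g x)).
Proof. by move=> af ag t x y; rewrite af ag. Qed.

Ltac affine := repeat first
  [ exact: affine_cst | exact: affine_id | apply: affine_fst | apply: affine_snd
  | apply: affine_pair | apply: affine_sub | apply: affine_opp | apply: affine_add
  | apply: affine_mulmx | apply: affine_dot ].

(** * The optimal cost of one area *)

Section AreaCost.
Context {R : realType} {n nb nbo l : nat}.
Variables (a : area R n nb nbo l) (xi : scenario R n).

(** The record [dispatch] has no module structure, so dispatches are carried over to a product of
    vector spaces. *)
Let X : lmodType R := ('cV[R]_n * 'cV[R]_n * 'cV[R]_n * 'cV[R]_n)%type.
Let to_dispatch (x : X) := Dispatch x.1.1.1 x.1.1.2 x.1.2 x.2.
Let of_dispatch (d : dispatch R n) : X := (gen d, wind d, load d, theta d).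

Let of_dispatchK d : to_dispatch (of_dispatch d) = d.
Proof. by case: d. Qed.

(** Boundary angles are variables here too: convexity of this joint set is what makes the optimal
    cost convex in them. *)
Let joint := [set p : X * ('cV[R]_nb * 'cV[R]_nbo) |
  feasible a xi p.2.1 p.2.2 (to_dispatch p.1)].

Let polyhedron_joint : polyhedron joint.
Proof.
pose Z : lmodType R := (X * ('cV[R]_nb * 'cV[R]_nbo))%type.
pose E1 := [set p : Z |
  B_ii a *m p.1.2 + B_ib a *m p.2.1 = p.1.1.1.1 + p.1.1.1.2 - p.1.1.2].
pose E2 := [set p : Z | B_bi a *m p.1.2 + B_bb a *m p.2.1 + B_bo a *m p.2.2 = 0].
pose le k (f g : Z -> 'cV[R]_k) := [set p | vle (f p) (g p)].
rewrite (_ : joint = E1 `&` E2 `&`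
  (le _ (fun=> G_min a) (fun p => p.1.1.1.1) `&`
   le _ (fun p => p.1.1.1.1) (fun=> G_max a) `&`
  (le _ (fun=> 0) (fun p => p.1.1.1.2) `&`
   le _ (fun p => p.1.1.1.2) (fun=> W_max xi)) `&`
  (le _ (fun=> D_min xi) (fun p => p.1.1.2) `&`
   le _ (fun p => p.1.1.2) (fun=> D_max xi))) `&`
  le _ (fun p => H_i a *m p.1.2 + H_b a *m p.2.1) (fun=> f_max a)).
  repeat (apply: polyhedronI).
  - by apply: polyhedron_mx_eq; affine.
  - by apply: polyhedron_mx_eq; affine.
  all: try by apply: polyhedron_coord_le; affine.
apply/seteqP; split=> p /=.
  by case=> ? ? [[? ?] [? ?] [? ?]] ?.
by move=> [[[? ?] [[[? ?] [? ?]] [? ?]]] ?]; split.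
Qed.

(** The phase angles may be unbounded but do not enter the cost; the asset limits bound the three
    quantities that do. The linear program is thus bounded below, and [minimum] is a true minimum
    rather than its default 0. *)
Lemma opt_cost_attained own other : feasible a xi own other !=set0 ->
  exists x, [/\ feasible a xi own other x, cost a xi x = opt_cost a xi own other &
    forall z, feasible a xi own other z -> opt_cost a xi own other <= cost a xi z].
Proof.
move=> [d0 fd0]; pose S := [set x | feasible a xi own other (to_dispatch x)].
have pS : polyhedron S.
  apply: (polyhedron_preimage _ (fun x => (x, (own, other))) _ _ polyhedron_joint).
  by affine.
have [Mg hg] := dot_lower_bound (P_g a) (G_min a) (G_max a).
have [Mw hw] := dot_lower_bound (P_w a) 0 (W_max xi).
have [Md hd] := dot_lower_bound (P_d a) 0 (D_max xi - D_min xi).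
have [x Sx xmin] : exists2 x, S x & forall z, S z ->
    cost a xi (to_dispatch x) <= cost a xi (to_dispatch z).
  apply: (polyhedron_attained S (fun x => cost a xi (to_dispatch x))
    (Mg + Mw + Md)) => //.
  - by rewrite /cost; affine.
  - move=> z [_ _ [[g1 g2] [w1 w2] [d1 d2]] _]; rewrite !lerD ?hg ?hw ?hd//.
    + by move=> i; have := w2 i; rewrite !mxE; lra.
    + by move=> i; have := w1 i; rewrite !mxE; lra.
    + by move=> i; have := d2 i; rewrite !mxE; lra.
    + by move=> i; have := d1 i; rewrite !mxE; lra.
  - by exists (of_dispatch d0); rewrite /S/= of_dispatchK.
have [[z fz zE] zmin] : ((cost a xi @` feasible a xi own other) `&`
    lbound (cost a xi @` feasible a xi own other)) (opt_cost a xi own other).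
  apply: xgetPex; exists (cost a xi (to_dispatch x)); split=> [|_ [z fz <-]].
    by exists (to_dispatch x).
  by rewrite -(of_dispatchK z); apply: xmin; rewrite /S/= of_dispatchK.
exists z; split=> // z' fz'; by apply: zmin; exists z'.
Qed.

(** The combination of two optimal dispatches is feasible for the combined boundary angles, and the
    cost is affine in the dispatch. *)
Lemma opt_cost_convex own1 other1 own2 other2 t :
  feasible a xi own1 other1 !=set0 -> feasible a xi own2 other2 !=set0 ->
  0 <= t <= 1 ->
  opt_cost a xi (own1 + t *: (own2 - own1)) (other1 + t *: (other2 - other1)) <=
  opt_cost a xi own1 other1 +
    t * (opt_cost a xi own2 other2 - opt_cost a xi own1 other1).
Proof.
move=> /opt_cost_attained[x1 [fx1 <- _]] /opt_cost_attained[x2 [fx2 <- _]] t01.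
pose v := of_dispatch x1 + t *: (of_dispatch x2 - of_dispatch x1).
have := polyhedron_cvx joint t (of_dispatch x1, (own1, other1))
  (of_dispatch x2, (own2, other2)) polyhedron_joint.
rewrite /joint/= !of_dispatchK => /(_ fx1 fx2 t01) fv.
have [_ [_ _ /(_ _ fv) optv]] := opt_cost_attained _ _ (ex_intro _ _ fv).
apply: le_trans optv _.
rewrite /cost/= !dotDr !dotNr !dotDr !dotZr !dotBr; lra.
Qed.

End AreaCost.

(** * Lexicographic minimizers *)

Section LexMinimizer.
Context {R : realType} {n : nat}.
Implicit Types (S : set 'cV[R]_n) (f : 'cV[R]_n -> R^o).

Lemma polytope_polyhedron S : polytope S -> polyhedron S.
Proof.
move=> [[m [A [b ->]]] _]; apply: (polyhedron_coord_le (mulmx A) (fun=> b)).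
  exact: affine_mulmx.
exact: affine_cst.
Qed.

Lemma lex_min_exists S : polyhedron S ->
  (exists M : R, forall z, S z -> forall i, M <= z i 0) -> S !=set0 ->
  exists2 z, S z & forall z', S z' -> z' <> z -> lex_lt z z'.
Proof.
move=> pS [M SM] [z0 Sz0].
(* Coordinates are minimized one after the other: after [k] rounds every point of [S] agrees with
   [z] on the first [k] coordinates or is already lexicographically larger within them. *)
have claim k : (k <= n)%N -> exists2 z, S z & forall z', S z' ->
    (forall j : 'I_n, (j < k)%N -> z' j 0 = z j 0) \/
    exists i : 'I_n, [/\ (i < k)%N, forall j : 'I_n, (j < i)%N -> z j 0 = z' j 0 &
      z i 0 < z' i 0]; last first.
  have [z Sz zmin] := claim n (leqnn n).
  exists z => // z' Sz' neq; case: (zmin _ Sz') => [h|[i [_ h1 h2]]]; last by exists i.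
  by exfalso; apply: neq; apply/matrixP => i j; rewrite (ord1 j); exact: h.
elim: k => [_|k IH kn]; first by exists z0 => // z' _; left.
have [z Sz zmin] := IH (ltnW kn); pose i := Ordinal kn.
pose S' := S `&` [set z' | forall j : 'I_n, (j < k)%N -> z' j 0 = z j 0].
pose T (j : 'I_n) := [set z' : 'cV[R]_n | (j < k)%N -> z' j 0 = z j 0].
have pT j : polyhedron (T j).
  have [jk|kj] := ltnP j k; last first.
    rewrite (_ : T j = setT); last first.
      by apply/seteqP; split=> // x _; rewrite /T/= ltnNge kj.
    by exists void, (fun _ _ => 0); split; [case|apply/seteqP; split=> // x _ []].
  rewrite (_ : T j = [set z' | z' j 0 = z j 0]); last first.
    by apply/seteqP; split=> x; rewrite /T/= jk //; exact.
  by apply: polyhedron_eq; [exact: (affine_coord id)|exact: affine_cst].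
have pS' : polyhedron S' by apply: polyhedronI => //; exact: (polyhedron_forall _ T).
have S'M x : S' x -> M <= x i 0 by move=> [Sx _]; exact: SM.
have [||x [Sx xz] xmin] := polyhedron_attained S' (fun x => x i 0) M pS' _ S'M.
- exact: (affine_coord id).
- by exists z; split.
exists x => // z' Sz'; have [h|[j [jk hj ltj]]] := zmin _ Sz'; last first.
  right; exists j; split=> [|j' j'j|]; rewrite ?xz//; first exact: leqW.
  - exact: hj.
  - exact: ltn_trans j'j jk.
have := xmin z' (conj Sz' h); rewrite le_eqVlt => /orP[/eqP xi|ltx].
  left=> j; rewrite ltnS leq_eqVlt => /orP[/eqP jk|jk].
    by rewrite (_ : j = i) //; exact: val_inj.
  by rewrite h// xz.
by right; exists i; split=> [||]; rewrite /= ?ltnSn// => j jk; rewrite xz// h.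
Qed.

Lemma bounded_dot S a : (exists M : R, forall z, S z -> enorm z <= M) ->
  exists M, forall z, S z -> M <= dot a z.
Proof.
move=> [M SM]; have [m hm] := dot_lower_bound a (const_mx (- M)) (const_mx M).
exists m => z /SM zM; apply: hm => i; rewrite mxE; have := coord_le_enorm z i;
  rewrite ler_norml => /andP[h1 h2]; lra.
Qed.

(** The minimizers of an affine function on a polyhedron form a polyhedron, cut out by one more
    inequality, to which [lex_min_exists] applies. *)
Lemma lex_minimizer_exists S a b : polyhedron S ->
  (exists M : R, forall z, S z -> enorm z <= M) -> S !=set0 ->
  exists z, lex_minimizer (fun z => dot a z + b) S z.
Proof.
move=> pS bS S0; have [m Sm] := bounded_dot _ a bS.
have aa : affine_map (fun z : 'cV[R]_n => dot a z : R^o).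
  by affine.
have [x Sx xmin] := polyhedron_attained _ _ m pS aa Sm S0.
have [|||z [Sz zx] zlex] := lex_min_exists (S `&` [set z | dot a z <= dot a x]).
- by apply: polyhedronI => //; apply: polyhedron_le => //; exact: affine_cst.
- have [M SM] := bS; exists (- M) => z [/SM zM _] i.
  by have := coord_le_enorm z i; rewrite ler_norml => /andP[]; lra.
- by exists x; split => /=.
have minE z' : minimizer (fun z => dot a z + b) S z' -> S z' /\ dot a z' <= dot a x.
  by move=> [Sz' h]; split=> //; have := h _ Sx; rewrite lerD2r.
exists z; split.
  by split=> // z' Sz'; rewrite lerD2r; exact: le_trans zx (xmin _ Sz').
by move=> z' /minE mz'; apply: zlex.
Qed.

Lemma lex_lt_asym (u v : 'cV[R]_n) : lex_lt u v -> ~ lex_lt v u.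
Proof.
move=> [i [hi lti]] [j [hj ltj]]; case: (ltngtP i j) => ij.
- by move: lti; rewrite hj// ltxx.
- by move: ltj; rewrite hi// ltxx.
- by move: ltj; rewrite -(val_inj ij) => /(lt_trans lti); rewrite ltxx.
Qed.

(** Thanks to this, a pair of regions determines its optimal point, so the incumbent takes finitely
    many values. *)
Lemma lex_minimizer_unique f S x y :
  lex_minimizer f S x -> lex_minimizer f S y -> x = y.
Proof.
move=> [mx lx] [my ly]; apply: contrapT => xy.
exact: lex_lt_asym (lx _ my (nesym xy)) (ly _ mx xy).
Qed.

End LexMinimizer.

(** * Minimum-norm points *)

Section ConvexHull.
Context {R : realType} {n : nat}.
Implicit Types (S C : set 'cV[R]_n) (x y : 'cV[R]_n).

Lemma convex_setE C : convex_set (C : set (convex_lmodType _)) <->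
  forall t x y, C x -> C y -> 0 <= t <= 1 -> C (t *: x + (1 - t) *: y).
Proof.
split=> [cC t x y Cx Cy /andP[t0 t1]|cC x y t]; last first.
  by rewrite !inE => Cx Cy; apply: cC => //; apply/andP.
have := cC x y (Itv01 t0 t1); rewrite !inE; exact.
Qed.

Lemma convex_hull_convex S : convex_set (convex_hull S : set (convex_lmodType _)).
Proof.
apply/convex_setE => t x y hx hy t01 C [cC SC].
by apply: (convex_setE C).1 => //; [exact: hx|exact: hy].
Qed.

(** Induction on the number of points: the last weight [t] is split off and the others are divided
    by [1 - t]. If [t = 1], they all vanish. *)
Lemma convex_set_sum C k (d : 'I_k -> 'cV[R]_n) (w : 'I_k -> R) :
  convex_set (C : set (convex_lmodType _)) -> (forall i, C (d i)) ->
  (forall i, 0 <= w i) -> \sum_i w i = 1 -> C (\sum_i w i *: d i).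
Proof.
move=> /convex_setE cC; elim: k d w => [d w _ _|k IH d w Cd w0].
  by rewrite big_ord0 => /esym/eqP; rewrite oner_eq0.
rewrite !big_ord_recr/=; set t := w ord_max => wt.
have s0 : 0 <= \sum_(i < k) w (widen_ord (leqnSn k) i) by rewrite sumr_ge0.
have t0 : 0 <= t by exact: w0.
have sE : \sum_(i < k) w (widen_ord (leqnSn k) i) = 1 - t by rewrite -wt addrK.
have [t1|t1] := eqVneq (1 - t) 0.
  rewrite big1 ?add0r => [|i _].
    have t1' : t = 1 by lra.
    by rewrite t1' scale1r; exact: Cd.
  suff -> : w (widen_ord (leqnSn k) i) = 0 by rewrite scale0r.
  move: sE; rewrite t1 => /eqP; rewrite psumr_eq0// => /allP.
  by move=> /(_ i (mem_index_enum _)) /eqP.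
rewrite addrC.
have -> : \sum_(i < k) w (widen_ord (leqnSn k) i) *: d (widen_ord (leqnSn k) i) =
    (1 - t) *: \sum_(i < k)
      (w (widen_ord (leqnSn k) i) / (1 - t)) *: d (widen_ord (leqnSn k) i).
  by rewrite scaler_sumr; apply: eq_bigr => i _; rewrite scalerA mulrC divfK.
apply: cC; [exact: Cd| |by rewrite t0; lra].
apply: IH => [i|i|]; [exact: Cd| |]; first by rewrite divr_ge0// -sE.
by rewrite -mulr_suml sE divff.
Qed.

Lemma convex_hull_range k (d : 'I_k -> 'cV[R]_n) :
  convex_hull (range d) = [set \sum_i w i *: d i |
    w in [set w : 'I_k -> R | (forall i, 0 <= w i) /\ \sum_i w i = 1]].
Proof.
apply/seteqP; split=> [|_ [w [w0 w1] <-]]; last first.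
  apply: convex_set_sum => //; first exact: convex_hull_convex.
  by move=> i; apply: sub_gen_smallest; exists i.
apply: smallest_sub => [|_ [i _ <-]].
  apply/convex_setE => t _ _ [w [w0 w1] <-] [w' [w'0 w'1] <-] /andP[t0 t1].
  exists (fun i => t * w i + (1 - t) * w' i); first split.
  - by move=> i; rewrite addr_ge0// mulr_ge0// subr_ge0.
  - by rewrite big_split/= -!mulr_sumr w1 w'1; ring.
  - rewrite !scaler_sumr -big_split/=; apply: eq_bigr => i _.
    by rewrite !scalerA scalerDl.
exists (fun j => (j == i)%:R); first split.
- by move=> j; exact: ler0n.
- by rewrite (bigD1 i)//= eqxx big1 ?addr0// => j /negbTE ->.
- by rewrite (bigD1 i)//= eqxx scale1r big1 ?addr0// => j /negbTE ->; rewrite scale0r.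
Qed.

End ConvexHull.

Lemma continuous_mulr (R : realType) (T : topologicalType) (f g : T -> R) :
  continuous f -> continuous g -> continuous (fun x => f x * g x).
Proof. by move=> cf cg x; apply: cvgM; [exact: cf|exact: cg]. Qed.

Lemma continuous_addr (R : realType) (T : topologicalType) (f g : T -> R) :
  continuous f -> continuous g -> continuous (fun x => f x + g x).
Proof. by move=> cf cg x; apply: cvgD; [exact: cf|exact: cg]. Qed.

Lemma continuous_sumr (R : realType) (T : topologicalType) k (F : 'I_k -> T -> R) :
  (forall i, continuous (F i)) -> continuous (fun x => \sum_i F i x).
Proof.
move=> cF; apply: (@continuous_big R _ +%R 0 xpredT (@add_continuous R)) => i _.
exact: cF.
Qed.

(** The index type may be infinite: the normal cone has one inequality for each point of [Y]. *)
Lemma closed_le0 (R : realType) (T : topologicalType) (I : Type) (g : I -> T -> R) :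
  (forall a, continuous (g a)) -> closed [set x | forall a, g a x <= 0].
Proof.
move=> cg; rewrite (_ : mkset _ = \bigcap_(a in setT) (g a @^-1` [set r | r <= 0])).
  by apply: closed_bigI => a _;
    apply: preimage_closed; [move=> x _; exact: cg|exact: closed_le].
by apply/seteqP; split=> x h a; [move=> _; exact: h|exact: h].
Qed.

Section MinimumNorm.
Context {R : realType} {n k : nat}.
Variables (d : 'I_k -> 'cV[R]_n) (Y : set 'cV[R]_n) (y : 'cV[R]_n).

(** A row vector encodes [k] convex weights followed by a vector of the normal cone; [point] is the
    element of the Minkowski sum it represents. *)
Let w (x : 'rV[R]_(k + n)) i := x 0 (lshift n i).
Let u (x : 'rV[R]_(k + n)) : 'cV[R]_n := \col_j x 0 (rshift k j).
Let point x := \sum_i w x i *: d i + u x.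

Let K (M : R) := [set x : 'rV[R]_(k + n) | [/\ forall i, 0 <= w x i,
  \sum_i w x i = 1, normal_cone Y y (u x) & forall j, `|x 0 j| <= M]].

Let compact_K M : compact (K M).
Proof.
have cc j : continuous (fun x : 'rV[R]_(k + n) => x 0 j) by exact: coord_continuous.
(* All conditions become inequalities [g a x <= 0]: nonnegative weights, total weight 1 as two
   signs, one condition per point of [Y], and both sides of the box. *)
pose T : Type := ('I_k + bool + {z | Y z} + ('I_(k + n) * bool))%type.
pose g (a : T) (x : 'rV[R]_(k + n)) : R := match a with
  | inl (inl (inl i)) => - w x i
  | inl (inl (inr b)) => (-1) ^+ b * (\sum_i w x i - 1)
  | inl (inr z) => \sum_j x 0 (rshift k j) * (sval z - y) j 0
  | inr (j, b) => (-1) ^+ (b : bool) * x 0 j - M end.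
have ccst (c : R) : continuous (fun _ : 'rV[R]_(k + n) => c) by exact: cst_continuous.
have cg a : continuous (g a).
  case: a => [[[i|b]|z]|[j b]]; rewrite /g.
  - by move=> x; apply: continuousN; exact: cc.
  - apply: continuous_mulr => //; apply: continuous_addr => //.
    by apply: continuous_sumr => i; exact: cc.
  - by apply: continuous_sumr => j; apply: continuous_mulr.
  - by apply: continuous_addr => //; exact: continuous_mulr.
have box : compact [set v : 'rV[R]_(k + n) | forall i, `[- M, M]%classic (v ord0 i)].
  by apply: (@rV_compact _ _ (fun=> `[- M, M]%classic)) => _; exact: segment_compact.
apply: subclosed_compact box _; last first.
  by move=> x [_ _ _ h] j /=; rewrite in_itv/= -ler_norml.
rewrite (_ : K M = [set x | forall a, g a x <= 0]); first exact: closed_le0.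
have gz (z : {z | Y z}) x : g (inl (inr z)) x = dot (u x) (sval z - y).
  by rewrite dotE; apply: eq_bigr => j _; rewrite [u x j 0]mxE.
apply/seteqP; split=> [x [x1 x2 x3 x4] [[[i|b]|z]|[j b]]|x h].
- by rewrite /= oppr_le0.
- by rewrite /= x2 subrr mulr0.
- by rewrite gz; apply: x3; exact: svalP.
- have := x4 j; rewrite ler_norml /= => /andP[? ?].
  by case: b; rewrite /= ?expr0 ?expr1; lra.
split.
- by move=> i; have := h (inl (inl (inl i))); rewrite /= oppr_le0.
- have := h (inl (inl (inr true))); have := h (inl (inl (inr false))).
  by rewrite /= expr0 expr1; lra.
- by move=> z Yz; have := h (inl (inr (exist _ z Yz))); rewrite gz.
- move=> j; have := h (inr (j, true)); have := h (inr (j, false)).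
  by rewrite /= expr0 expr1 ler_norml => ? ?; apply/andP; split; lra.
Qed.

(** The cone is unbounded, but elements longer than [d i0] cannot be minimal, and the others are
    represented in the compact set [K M], where the norm attains its minimum. *)
Lemma min_norm_exists : (0 < k)%N -> exists v,
  minimizer (@enorm R n)
    (minkowski_sum (convex_hull (range d)) (normal_cone Y y)) v.
Proof.
move=> k0; pose i0 := Ordinal k0.
pose B : R := \sum_i \sum_j `|d i j 0|.
have dB i j : `|d i j 0| <= B.
  rewrite /B (bigD1 i)//= (bigD1 j)//= -addrA lerDl addr_ge0// ?sumr_ge0// => i' _.
  by rewrite sumr_ge0.
(* The weights are at most 1. A cone vector is an element of the sum, of norm at most
   [enorm (d i0)], minus a convex combination with coordinates at most [B]. *)
pose M : R := 1 + B + enorm (d i0).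
have B0 : 0 <= B by rewrite sumr_ge0// => i _; rewrite sumr_ge0.
have e0 : 0 <= enorm (d i0) by exact: sqrtr_ge0.
pose x0 : 'rV[R]_(k + n) := delta_mx 0 (lshift n i0).
have wx0 i : w x0 i = (i == i0)%:R.
  by rewrite /w mxE /= (inj_eq (@lshift_inj _ _)).
have ux0 : u x0 = 0.
  by apply/matrixP => j j'; rewrite !mxE eq_rlshift andbF.
have px0 : point x0 = d i0.
  rewrite /point ux0 addr0 (bigD1 i0)//= wx0 eqxx scale1r big1 ?addr0// => i ne.
  by rewrite wx0 (negbTE ne) scale0r.
have Kx0 : K M x0.
  split.
  - by move=> i; rewrite wx0 ler0n.
  - by rewrite (bigD1 i0)//= wx0 eqxx big1 ?addr0// => i ne; rewrite wx0 (negbTE ne).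
  - by move=> z _; rewrite ux0 dot0l.
  - move=> j; rewrite mxE eqxx/=; case: (j == _); rewrite ?normr1 ?normr0 /M; lra.
have Fc : continuous (fun x => dot (point x) (point x)).
  pose h j (x : 'rV[R]_(k + n)) := \sum_i w x i * d i j 0 + x 0 (rshift k j).
  rewrite (_ : (fun x => _) = (fun x => \sum_j h j x * h j x)); last first.
    apply/funext => x; rewrite dotE; apply: eq_bigr => j _.
    suff -> : point x j 0 = h j x by [].
    by rewrite mxE summxE mxE; congr (_ + _); apply: eq_bigr => i _; rewrite mxE.
  have cc j : continuous (fun x : 'rV[R]_(k + n) => x 0 j) by exact: coord_continuous.
  have ch j : continuous (h j).
    apply: continuous_addr => //; apply: continuous_sumr => i.
    by apply: continuous_mulr; [exact: cc|exact: cst_continuous].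
  by apply: continuous_sumr => j; exact: continuous_mulr.
have [||x xK xmin] := @compact_EVT_min _ _
  (fun x => dot (point x) (point x)) (K M) _ (compact_K M).
- by exists x0.
- exact: continuous_subspaceT.
move: xK; rewrite inE => -[x1 x2 x3 x4].
exists (point x); split.
  exists (\sum_i w x i *: d i); first by rewrite convex_hull_range; exists (w x).
  by exists (u x).
move=> _ [p + [u' Nu' <-]]; rewrite convex_hull_range => -[w' [w'0 w'1] <-].
rewrite enorm_le.
(* A competitor at least as long as [d i0] is beaten through [x0]; a shorter one is encoded by a
   point of [K M]. *)
have [le0|gt0] := leP (dot (d i0) (d i0))
  (dot (\sum_i w' i *: d i + u') (\sum_i w' i *: d i + u')).
  by apply: le_trans le0; rewrite -px0; apply: xmin; rewrite inE.
pose x' : 'rV[R]_(k + n) := row_mx (\row_i w' i) u'^T.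
have wx' i : w x' i = w' i by rewrite /w row_mxEl mxE.
have ux' : u x' = u' by apply/matrixP => j j'; rewrite mxE row_mxEr mxE (ord1 j').
have px' : point x' = \sum_i w' i *: d i + u'.
  by rewrite /point ux'; congr (_ + _); apply: eq_bigr => i _; rewrite wx'.
rewrite -px'; apply: xmin; rewrite inE; split.
- by move=> i; rewrite wx'.
- by rewrite -w'1; apply: eq_bigr => i _; rewrite wx'.
- by rewrite ux'.
have w'le i : w' i <= 1.
  by rewrite -w'1 (bigD1 i)//= lerDl sumr_ge0.
move=> j; rewrite /x' -[j]splitK; case: (fintype.split j) => i /=.
  by rewrite row_mxEl mxE ger0_norm//; have := w'le i; rewrite /M; lra.
rewrite row_mxEr mxE.
have h1 := coord_le_enorm (\sum_i w' i *: d i + u') i.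
have h2 : enorm (\sum_i w' i *: d i + u') <= enorm (d i0) by rewrite enorm_le ltW.
have h3 : `|(\sum_i w' i *: d i) i 0| <= B.
  rewrite summxE; apply: le_trans (ler_norm_sum _ _ _) _.
  apply: ler_sum => i' _; rewrite mxE normrM ger0_norm//.
  apply: le_trans (ler_piMl _ (w'le _)) _ => //.
  by rewrite (bigD1 i)//= lerDl sumr_ge0.
have : `|u' i 0| <= `|(\sum_i w' i *: d i + u') i 0| + `|(\sum_i w' i *: d i) i 0|.
  set s := \sum_i w' i *: d i; rewrite mxE.
  have {1}-> : u' i 0 = s i 0 + u' i 0 - s i 0 by ring.
  exact: ler_normB.
by rewrite /M; lra.
Qed.

End MinimumNorm.

(** * The minimum-norm element as a step direction *)

Section MinimumNormDirection.
Context {R : realType} {n : nat}.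
Implicit Types (C D Y : set 'cV[R]_n) (u v y z : 'cV[R]_n).

(** The variational inequality of a projection: were it to fail, moving slightly from [v] towards
    [p] would shorten [v]. *)
Lemma min_norm_dot C v p : convex_set (C : set (convex_lmodType _)) ->
  minimizer (@enorm R n) C v -> C p -> dot v v <= dot v p.
Proof.
move=> /convex_setE cC [Cv vmin] Cp; rewrite leNgt; apply/negP => lt.
pose q := p - v; pose a := - dot v q; pose b := dot q q.
have a0 : 0 < a by rewrite /a /q dotBr; lra.
have b0 : 0 <= b by exact: dot_ge0.
(* The squared norm changes by [t * (t * b - 2 * a)]. Adding [a] to the denominator covers [b = 0],
   keeps [t] at most 1 and gives [t * b = a - t * a < 2 * a]. *)
pose t := a / (a + b).
have ab0 : 0 < a + b by lra.
have t0 : 0 < t by exact: divr_gt0.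
have t1 : t <= 1 by rewrite ler_pdivrMr// mul1r lerDl.
have := vmin (v + t *: q).
have vq : v + t *: q = t *: p + (1 - t) *: v.
  by apply/matrixP => i j; rewrite !mxE; ring.
rewrite vq.
move=> /(_ (cC _ _ _ Cp Cv _)); rewrite enorm_le ltW//= t1 => /(_ isT).
rewrite -vq dotDr !dotDl !dotZl !dotZr (dotC q v) -/b -[dot v q]opprK -/a.
move=> h.
have h1 : t * (t * b - 2 * a) >= 0 by lra.
have tb : t * (a + b) = a by rewrite /t divfK// gt_eqF.
have : 0 <= t * b - 2 * a by rewrite pmulr_rge0 in h1.
have := mulr_gt0 t0 a0.
lra.
Qed.

Lemma normal_cone_convex Y y : convex_set (normal_cone Y y : set (convex_lmodType _)).
Proof.
apply/convex_setE => t u v Nu Nv /andP[t0 t1] z Yz; rewrite dotDl !dotZl.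
have := mulr_ge0_le0 t0 (Nu _ Yz).
have := mulr_ge0_le0 (_ : 0 <= 1 - t) (Nv _ Yz); rewrite subr_ge0 => /(_ t1).
lra.
Qed.

Lemma minkowski_sum_convex C D : convex_set (C : set (convex_lmodType _)) ->
  convex_set (D : set (convex_lmodType _)) ->
  convex_set (minkowski_sum C D : set (convex_lmodType _)).
Proof.
move=> /convex_setE cC /convex_setE cD; apply/convex_setE.
move=> t _ _ [x Cx [u Du <-]] [y Cy [v Dv <-]] t01.
exists (t *: x + (1 - t) *: y); first exact: cC.
exists (t *: u + (1 - t) *: v); first exact: cD.
by rewrite !scalerDr addrACA.
Qed.

Definition cut_cone D Y y := minkowski_sum (convex_hull D) (normal_cone Y y).

Lemma cut_cone_convex D Y y : convex_set (cut_cone D Y y : set (convex_lmodType _)).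
Proof.
apply: minkowski_sum_convex; [exact: convex_hull_convex|exact: normal_cone_convex].
Qed.

Lemma min_norm_unique C v w : convex_set (C : set (convex_lmodType _)) ->
  minimizer (@enorm R n) C v -> minimizer (@enorm R n) C w -> v = w.
Proof.
move=> cC mv mw; apply/eqP; rewrite -subr_eq0; apply/eqP/dot_eq0.
rewrite dotBr !dotBl; have := min_norm_dot _ _ _ cC mv mw.1.
by have := min_norm_dot _ _ _ cC mw mv.1; rewrite (dotC w v); lra.
Qed.

Lemma min_norm_cut D Y y v a : minimizer (@enorm R n) (cut_cone D Y y) v -> D a ->
  dot v v <= dot v a.
Proof.
move=> mv Da; apply: (min_norm_dot _ _ _ (cut_cone_convex D Y y) mv).
exists a; first exact: sub_gen_smallest.
by exists 0; rewrite ?addr0// => z _; rewrite dot0l.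
Qed.

(** The normal cone is closed under addition, so [v + a] is again in the sum. Consequently [- v] has
    nonpositive product with every normal vector. *)
Lemma min_norm_normal D Y y v a : minimizer (@enorm R n) (cut_cone D Y y) v ->
  normal_cone Y y a -> 0 <= dot v a.
Proof.
move=> mv Na; have : dot v v <= dot v (v + a).
  apply: (min_norm_dot _ _ _ (cut_cone_convex D Y y) mv).
  have [[s Ds [u Nu <-]] _] := mv; exists s => //; exists (u + a); last exact: addrA.
  move=> z Yz; rewrite dotDl; have := Nu _ Yz; have := Na _ Yz; lra.
by rewrite dotDr lerDl.
Qed.

Lemma near_affine_lt0 (c b : R) : c < 0 -> \forall e \near 0^'+, c + e * b < 0.
Proof.
move=> c0; near=> e.
have e0 : 0 < e by near: e; exact: nbhs_right_gt.
have : e < - c / (1 + `|b|).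
  by near: e; apply: nbhs_right_lt; rewrite divr_gt0 ?oppr_gt0// ltr_pwDl.
rewrite ltr_pdivlMr ?ltr_pwDl// => h.
have := ler_norm b; rewrite -(ler_pM2l e0) => h2.
by lra.
Unshelve. all: by end_near. Qed.

(** A constraint violated at [y] remains violated after a short step; hence short steps enter no new
    region. *)
Lemma near_polyhedron_out (P : set 'cV[R]_n) y v : polyhedron P -> ~ P y ->
  \forall e \near 0^'+, ~ P (y - e *: v).
Proof.
move=> [I [l [al ->]]] /existsNP[i /negP]; rewrite -ltNge => liy.
have [a la] := affine_functional _ (al i).
have ly : - l i y < 0 by rewrite oppr_lt0.
have := near_affine_lt0 _ (dot a v) ly; apply: filterS => e h Py.
have := Py i; have := la y (y - e *: v).
by rewrite (addrC y) addrK dotNr dotZr; lra.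
Qed.

(* The gradient of a constraint active at [y] lies in the normal cone, so [- v]
   does not increase it. *)
Lemma near_min_norm_step D Y y v : polyhedron Y -> Y y ->
  minimizer (@enorm R n) (cut_cone D Y y) v -> \forall e \near 0^'+, Y (y - e *: v).
Proof.
move=> [I [l [al YE]]] Yy mv; rewrite YE; apply: filter_forall => i.
have [a la] := affine_functional _ (al i).
have lE e : l i (y - e *: v) = l i y + e * - dot v a.
  have := la y (y - e *: v); rewrite (addrC y) addrK dotNr dotZr (dotC a).
  by lra.
have := Yy; rewrite YE => /(_ i); rewrite le_eqVlt => /orP[/eqP liy|liy].
  have va : 0 <= dot v a.
    apply: min_norm_normal mv _ => z Yz.
    by rewrite -la liy subr0; move: Yz; rewrite YE; exact.
  have := nbhs_right_ge (0 : R); apply: filterS => e e0.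
  by rewrite /= lE liy add0r mulr_ge0_le0// oppr_le0.
have := near_affine_lt0 _ (- dot v a) liy; apply: filterS => e.
by rewrite /= lE => /ltW.
Qed.

End MinimumNormDirection.

(** * Affine dimension and minorants *)

Section FullDimensional.
Context {R : realType} {n : nat}.
Implicit Types (P Y : set 'cV[R]_n).

(** Appending a coordinate 1 to each point gives [n + 2] rows of length [n + 1]; a nonzero vector of
    the left kernel is an affine dependence. *)
Lemma affinely_dependent (p : 'I_n.+2 -> 'cV[R]_n) : ~ affinely_independent p.
Proof.
pose A : 'M[R]_(n.+2, n + 1) := row_mx (\matrix_(i, j) p i j 0) (const_mx 1).
have : kermx A != 0.
  rewrite -mxrank_eq0 mxrank_ker subn_eq0 -ltnNge (leq_ltn_trans (rank_leq_col _))//.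
  by rewrite addn1.
move=> /rowV0Pn[w /sub_kermxP wA wn0] /(_ (fun i => w 0 i)) ind.
move: wA; rewrite /A mul_mx_row -row_mx0 => /eq_row_mx[wp w1].
move: wn0; apply/negP; rewrite negbK; apply/eqP/matrixP => i j.
rewrite (ord1 i) mxE; apply: ind.
  transitivity ((w *m const_mx 1 : 'M[R]_1) 0 0); last by rewrite w1 mxE.
  by rewrite mxE; apply: eq_bigr => k _; rewrite mxE mulr1.
apply/matrixP => k l; rewrite (ord1 l) summxE.
transitivity ((w *m \matrix_(i, j) p i j 0) 0 k); last by rewrite wp !mxE.
by rewrite mxE; apply: eq_bigr => i' _; rewrite !mxE.
Qed.

(** This is [affine_dim] plus one, kept as a natural number so that it can index families of
    points. *)
Definition affine_rank (S : set 'cV[R]_n) : nat :=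
  (\max_(k < n.+2 | `[< exists p : 'I_k -> 'cV[R]_n,
      (forall i, S (p i)) /\ affinely_independent p >]) (k : nat))%N.

(** The maximum only ranges up to [n + 1]. The case [k = n + 2], possible when a point is added to a
    largest family, is excluded by [affinely_dependent]. *)
Lemma affine_rank_max S k (p : 'I_k -> 'cV[R]_n) : (k <= n.+2)%N ->
  (forall i, S (p i)) -> affinely_independent p -> (k <= affine_rank S)%N.
Proof.
rewrite leq_eqVlt => /orP[/eqP kE|kn] Sp ip.
  by subst k; case: (affinely_dependent p).
by apply: (bigop.bigmax_sup (Ordinal kn)) => //; apply/asboolP; exists p.
Qed.

Lemma affine_rank_le S : (affine_rank S <= n.+1)%N.
Proof. by apply/bigmax_leqP => k _; rewrite -ltnS. Qed.

Lemma affine_rank_attained S : exists p : 'I_(affine_rank S) -> 'cV[R]_n,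
  (forall i, S (p i)) /\ affinely_independent p.
Proof.
pose Q : pred 'I_n.+2 := fun k => `[< exists p : 'I_k -> 'cV[R]_n,
  (forall i, S (p i)) /\ affinely_independent p >].
have [|k /asboolP h kE] := @eq_bigmax_cond _ Q (fun k => k : nat).
  apply/card_gt0P; exists ord0; apply/asboolP.
  by exists (fun _ => 0); split=> [[]//|w _ _ []].
by have -> : affine_rank S = k by exact: kE.
Qed.

(** Adding [z] to a largest independent family makes it dependent; the coefficient of [z] in the
    relation is nonzero, so the relation can be solved for [z]. *)
Lemma affine_combination S (p : 'I_(affine_rank S) -> 'cV[R]_n) z :
  (forall i, S (p i)) -> affinely_independent p -> S z ->
  exists w, \sum_i w i = 1 /\ \sum_i w i *: p i = z.
Proof.
move=> Sp ip Sz; apply: contrapT => no.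
pose p' (i : 'I_(affine_rank S).+1) := if unlift ord_max i is Some j then p j else z.
have p'S i : S (p' i) by rewrite /p'; case: unliftP.
have p'l i : p' (widen_ord (leqnSn _) i) = p i.
  have -> : widen_ord (leqnSn _) i = lift ord_max i by apply: ord_inj; rewrite lift_max.
  by rewrite /p' liftK.
have p'm : p' ord_max = z by rewrite /p' unlift_none.
suff : affinely_independent p'.
  by move=> /(affine_rank_max S _ p' (affine_rank_le S) p'S); rewrite ltnn.
move=> w; rewrite !big_ord_recr/= p'm; set t := w ord_max => wt wz.
pose w' i := w (widen_ord (leqnSn (affine_rank S)) i).
rewrite -/w' in wt wz.
have {}wz : \sum_i w' i *: p i + t *: z = 0.
  by rewrite -[RHS]wz; congr (_ + _); apply: eq_bigr => i _; rewrite p'l.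
have t0 : t = 0.
  apply/eqP/negP => /negP t0; apply: no; exists (fun i => - w' i / t); split.
    move/eqP: wt; rewrite addr_eq0 => /eqP wt.
    by rewrite -mulr_suml sumrN wt opprK divff.
  transitivity (- t^-1 *: \sum_i w' i *: p i).
    by rewrite scaler_sumr; apply: eq_bigr => i _; rewrite scalerA mulrC mulrN mulNr.
  move/eqP: wz; rewrite addr_eq0 => /eqP ->.
  by rewrite scalerN scaleNr opprK scalerA mulVf// scale1r.
move: wt wz; rewrite t0 addr0 scale0r addr0 => wt wz i.
have [j ->|->] := unliftP ord_max i; last exact: t0.
have -> : lift ord_max j = widen_ord (leqnSn _) j by apply: ord_inj; rewrite lift_max.
exact: (ip w').
Qed.

(* [p] is the barycenter of a largest affinely independent family of points of [P],
   which spans [Y] affinely. *)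
Lemma full_dimensional_interior P Y : polyhedron P -> P `<=` Y -> Y !=set0 ->
  affine_dim P = affine_dim Y ->
  exists2 p, P p & forall z, Y z -> exists t, [/\ 0 < t, t <= 1 & P (p + t *: (z - p))].
Proof.
move=> pP PY [y0 Yy0] /addIr [rk].
have {}rk : affine_rank P = affine_rank Y by [].
have [] := affine_rank_attained P; rewrite rk => q [Pq iq].
set k := affine_rank Y in q Pq iq.
have k0 : (0 < k)%N.
  apply: (affine_rank_max Y 1 (fun _ => y0)) => // w.
  by rewrite big_ord1 => w0 _ i; rewrite (ord1 i).
pose s : R := k%:R^-1.
have s0 : 0 < s by rewrite invr_gt0 ltr0n.
have s1 : \sum_(i < k) s = 1.
  by rewrite sumr_const card_ord -[s *+ k]mulr_natr mulVf// pnatr_eq0 -lt0n.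
have Pc : convex_set (P : set (convex_lmodType _)).
  apply/convex_setE => t x y Px Py t01.
  have := polyhedron_cvx _ t y x pP Py Px t01; congr P.
  by apply/matrixP => i j; rewrite !mxE; ring.
exists (\sum_i s *: q i).
  by apply: convex_set_sum => // i; exact: ltW.
move=> z Yz; have [w [w1 wz]] := affine_combination Y q z (fun i => PY _ (Pq i)) iq Yz.
(* With this [t], each weight satisfies [s + t * (w i - s) >= s - t * (s + B) = 0]. *)
pose B := \sum_i `|w i|; pose t := s / (s + B).
have B0 : 0 <= B by exact: sumr_ge0.
have sB : 0 < s + B by lra.
have t0 : 0 < t by exact: divr_gt0.
have t1 : t <= 1 by rewrite ler_pdivrMr// mul1r lerDl.
have tsB : t * (s + B) = s by rewrite /t divfK// gt_eqF.
exists t; split=> //.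
rewrite -wz (_ : _ + _ = \sum_i (s + t * (w i - s)) *: q i).
  apply: convex_set_sum => // [i|].
    have : `|w i| <= B by rewrite /B (bigD1 i)//= lerDl sumr_ge0.
    move=> wB; have := ler_norm (- w i); rewrite normrN => h.
    have : t * - w i <= t * B by rewrite ler_pM2l//; exact: le_trans h wB.
    lra.
  by rewrite big_split/= -mulr_sumr sumrB w1 s1; ring.
rewrite -sumrB scaler_sumr -big_split/=; apply: eq_bigr => i _.
by apply/matrixP => i' j; rewrite !mxE; ring.
Qed.

(** From a relative interior point [p], a short move towards [z] stays in [P], where [J] is affine;
    convexity on the segment puts [J z] above the affine extrapolation. *)
Lemma affine_piece_minorant (J : 'cV[R]_n -> R) P Y a b :
  polyhedron P -> P `<=` Y -> Y !=set0 -> affine_dim P = affine_dim Y ->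
  (forall t y z, Y y -> Y z -> 0 <= t <= 1 ->
    J (y + t *: (z - y)) <= J y + t * (J z - J y)) ->
  (forall z, P z -> J z = dot a z + b) ->
  forall z, Y z -> dot a z + b <= J z.
Proof.
move=> pP PY Y0 dPY cJ JP z Yz.
have [p Pp /(_ z Yz)[t [t0 t1 Pt]]] := full_dimensional_interior P Y pP PY Y0 dPY.
have := cJ t p z (PY _ Pp) Yz; rewrite (ltW t0) t1 => /(_ isT).
rewrite (JP _ Pt) (JP _ Pp) dotDr dotZr dotBr => h.
rewrite -(ler_pM2l t0); lra.
Qed.

End FullDimensional.

(** * The algorithm *)

Section Exploration.
Context {R : realType} {N : nat}.
Variables (Y : set 'cV[R]_N) (c1 c2 : regions R N) (J1 J2 : 'cV[R]_N -> R).
Hypotheses (pY : polyhedron Y) (Y0 : Y !=set0).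
Hypotheses (crit1 : critical_regions Y J1 c1) (crit2 : critical_regions Y J2 c2).

Let convex_on (J : 'cV[R]_N -> R) := forall t y z, Y y -> Y z -> 0 <= t <= 1 ->
  J (y + t *: (z - y)) <= J y + t * (J z - J y).
Hypotheses (cvx1 : convex_on J1) (cvx2 : convex_on J2).

Let F : finType := ('I_(nreg c1) * 'I_(nreg c2))%type.
Let reg (f : F) : set 'cV[R]_N := region f.1 `&` region f.2.
Let al (f : F) : 'cV[R]_N := slope f.1 + slope f.2.
Let be (f : F) : R := intercept f.1 + intercept f.2.
Let J z := J1 z + J2 z.
Let cost f z := dot (al f) z + be f.
Let opt f z := lex_minimizer (cost f) (reg f) z.
(** Cut sets are described by sets of region pairs, of which there are finitely many. *)
Let slopes (A : {set F}) : set 'cV[R]_N := al @` [set` A].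

Let region_polyhedron J' c r : critical_regions Y J' c ->
  polyhedron (@region R N c r).
Proof. by move=> [[h _ _] _ _]; exact: polytope_polyhedron. Qed.

Let region_sub J' c r : critical_regions Y J' c -> @region R N c r `<=` Y.
Proof. by move=> [[_ _ <-] _ _] z hz; exists r. Qed.

Let regY f : reg f `<=` Y.
Proof. by move=> z [/(region_sub _ _ _ crit1)]. Qed.

Let J_reg f z : reg f z -> J z = cost f z.
Proof.
case: crit1 crit2 => _ _ h1 [_ _ h2] [/h1 e1 /h2 e2].
by rewrite /J e1 e2 /cost /al dotDl /be; ring.
Qed.

Let region_minorant J' c r z : critical_regions Y J' c -> convex_on J' -> Y z ->
  dot (@slope R N c r) z + intercept r <= J' z.
Proof.
move=> cr cJ; apply: (affine_piece_minorant J' (region r)) => //.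
- exact: region_polyhedron cr.
- exact: region_sub cr.
- by case: cr.
- by case: cr => _ _; exact.
Qed.

Let cost_le f z : Y z -> cost f z <= J z.
Proof.
move=> Yz; have := region_minorant _ _ f.1 _ crit1 cvx1 Yz.
have := region_minorant _ _ f.2 _ crit2 cvx2 Yz.
by rewrite /cost /al /be /J dotDl; lra.
Qed.

Let opt_exists f : reg f !=set0 -> exists z, opt f z.
Proof.
apply: lex_minimizer_exists.
  apply: polyhedronI; first exact: region_polyhedron crit1.
  exact: region_polyhedron crit2.
case: crit1 => -[h _ _] _ _; have [_ [M hM]] := h f.1.
by exists M => z [/hM].
Qed.

Let min_norm A y v := minimizer (@enorm R N) (cut_cone (slopes A) Y y) v.

Let min_norm_ex (A : {set F}) y f : f \in A -> exists v, min_norm A y v.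
Proof.
move=> fA; pose d (i : 'I_#|A|) := al (enum_val i).
rewrite /min_norm (_ : slopes A = range d); last first.
  apply/seteqP; split=> [_ [g gA <-]|_ [i _ <-]].
    by exists (enum_rank_in fA g) => //; rewrite /d enum_rankK_in.
  by exists (enum_val i) => //; exact: enum_valP.
by apply: min_norm_exists; apply/card_gt0P; exists f.
Qed.

(** The only smallness condition on the step size. It ranges over all pairs and all cut sets,
    whether or not an execution meets them, so the threshold does not depend on the execution. *)
Definition faithful_step eps := forall (f : F) (A : {set F}) y v,
  opt f y -> min_norm A y v ->
  Y (y - eps *: v) /\ forall g, reg g (y - eps *: v) -> reg g y.

(** Each [f] and [A] determine at most one [y] and one [v], so finitely many conditions on [eps] are
    intersected, each true near 0. *)
Let near_good : \forall eps \near 0^'+, faithful_step eps.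
Proof.
suff : \forall eps \near 0^'+, forall fA : F * {set F}, forall y v,
    opt fA.1 y -> min_norm fA.2 y v ->
    Y (y - eps *: v) /\ forall g, reg g (y - eps *: v) -> reg g y.
  by apply: filterS => eps h f A; exact: (h (f, A)).
apply: filter_forall => -[f A] /=.
have [[[y v] [oy mv]]|no] := pselect (exists yv, opt f yv.1 /\ min_norm A yv.1 yv.2);
  last by apply: nearW => eps y v oy mv; case: no; exists (y, v).
have Yy : Y y by apply: regY; case: oy => -[ry _] _; exact: ry.
have step := near_min_norm_step _ _ _ _ pY Yy mv.
have out J' c (cr : critical_regions Y J' c) : \forall eps \near 0^'+,
    forall r, @region R N c r (y - eps *: v) -> region r y.
  apply: filter_forall => r; have [ry|nry] := pselect (region r y).
    by apply: nearW => eps _.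
  have := near_polyhedron_out _ _ v (region_polyhedron _ _ r cr) nry.
  by apply: filterS => eps h /h.
apply: filterS (filterI step (filterI (out _ _ crit1) (out _ _ crit2))).
move=> eps [Ye [o1 o2]] y' v' oy' mv'.
have yy : y' = y by exact: lex_minimizer_unique oy' oy.
rewrite yy in mv' *.
have -> : v' = v by apply: min_norm_unique mv' mv; exact: cut_cone_convex.
by split=> // g [r1 r2]; split; [exact: o1|exact: o2].
Qed.

Lemma exploration_threshold : exists eps0 : R, 0 < eps0 /\
  forall eps, 0 < eps -> eps < eps0 -> faithful_step eps.
Proof.
have /nbhs_ballP[e /= e0 he] := near_good.
exists e; split=> // eps eps0 epse; apply: he => //.
by rewrite /ball /= sub0r normrN gtr0_norm.
Qed.

Variable eps : R.
Hypotheses (eps0 : 0 < eps) (eps_good : faithful_step eps).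

Let state := state R N.
Let iter r1 r2 v (s s' : state) := @iteration R N Y c1 c2 eps r1 r2 v s s'.

(* [s] follows an iteration with minimum-norm element [v]. *)
Let after (A : {set F}) v (s : state) := exists f,
  [/\ opt f (incumbent s), value s = (J (incumbent s))%:E,
      forall g, g \in A -> reg g (incumbent s), min_norm A (incumbent s) v &
      query s = incumbent s - eps *: v].

(** Nothing is known of the incumbent before the first pass; later, the last minimum-norm element is
    nonzero because the loop continued. *)
Let invariant (s : state) := exists A : {set F}, cuts s = slopes A /\
  ([/\ Y (query s), value s = +oo%E & A = finset.set0] \/
   exists2 v, v <> 0 & after A v s).

Let invariant_query s : invariant s -> Y (query s).
Proof.
by move=> [A [_ [[]//|[v _ [f [of_ _ _ mv ->]]]]]]; case: (eps_good _ _ _ _ of_ mv).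
Qed.

Let slopes1 f : slopes [set f]%SET = [set al f].
Proof.
apply/seteqP; split=> [_ [g + <-]|_ ->]; first by rewrite /= inE => /eqP ->.
by exists f => //=; rewrite inE.
Qed.

Let slopesU1 f A : slopes (f |: A)%SET = slopes A `|` [set al f].
Proof.
apply/seteqP; split=> [_ [g + <-]|_ [[g gA <-]|->]].
- by rewrite /= !inE => /orP[/eqP ->|gA]; [right|left; exists g].
- by exists g => //=; rewrite !inE (gA : g \in A) orbT.
- by exists f => //=; rewrite !inE eqxx.
Qed.

Let improving (s : state) : {set F} :=
  [set f | `[< exists2 z, opt f z & ((cost f z)%:E < value s)%E >]]%SET.
Let unseen (s : state) : {set F} := [set f | `[< ~ cuts s (al f) >]]%SET.
Let improvingP s f :
  reflect (exists2 z, opt f z & ((cost f z)%:E < value s)%E) (f \in improving s).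
Proof. by rewrite finset.in_set; exact: asboolP. Qed.

Let unseenP s f : reflect (~ cuts s (al f)) (f \in unseen s).
Proof. by rewrite finset.in_set; exact: asboolP. Qed.

(* The lexicographic order on the two cardinals, as [#|unseen s| <= #|F|]. *)
Let rank (s : state) := (#|improving s| * #|F|.+1 + #|unseen s|)%N.

Let iteration_invariant r1 r2 v s s' : invariant s -> iter r1 r2 v s s' ->
  (exists A : {set F}, cuts s' = slopes A /\ after A v s') /\ (rank s' < rank s)%N.
Proof.
move=> [A [cs inv]]; pose f : F := (r1, r2); rewrite /iter /iteration.
rewrite -/(al f) -/(be f) -/(reg f) => -[Pq [yopt oy]]; rewrite -/(cost f yopt).
have ry : reg f yopt by case: oy => -[].
case: ifPn => [lt [is' vs' cs'] mv qs'|].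
  split.
    exists [set f]%SET; rewrite slopes1; split=> //; exists f; split=> //.
    - by rewrite is'.
    - by rewrite vs' is' (J_reg f).
    - by move=> g; rewrite inE is' => /eqP ->.
    - by rewrite /min_norm slopes1 -cs'.
  (* The pair [f] leaves the improving set, its optimum being the new value. Resetting the cuts may
     enlarge [unseen], but by less than the weight [#|F|.+1]. *)
  have lt1 : (#|improving s'| < #|improving s|)%N.
    apply: proper_card; apply/properP; split.
      apply/fintype.subsetP => g /improvingP[z oz zs'].
      by apply/improvingP; exists z => //; apply: lt_trans zs' _; rewrite vs'.
    exists f; first by apply/improvingP; exists yopt.
    apply/improvingP => -[z oz]; rewrite vs' (lex_minimizer_unique _ _ _ _ oz oy).
    by rewrite ltxx.
  have uF : (#|unseen s'| <= #|F|)%N by exact: max_card.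
  by have := leq_mul lt1 (leqnn #|F|.+1); rewrite /rank mulSn; lia.
rewrite -leNgt => ge [is' vs' cs'] mv qs'.
case: inv => [[_ vs _]|[v0 v00 [f0 [of0 vs rA mv0 qs]]]].
  by move: ge; rewrite vs.
(* The regions returned at the query also contain the incumbent, so the new cut preserves the
   invariant. *)
have [_ /(_ f)] := eps_good _ _ _ _ of0 mv0; rewrite -qs => /(_ Pq) rinc.
split.
  exists (f |: A)%SET; rewrite slopesU1 -cs; split=> //; exists f0; split.
  - by rewrite is'.
  - by rewrite vs' is'.
  - by move=> g; rewrite !inE is' => /orP[/eqP ->|/rA].
  - by rewrite /min_norm slopesU1 -cs -cs'.
  - exact: qs'.
have nf : ~ cuts s (al f).
  rewrite cs => Af; have := min_norm_cut _ _ _ _ _ mv0 Af.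
  (* Both the incumbent and the query lie in [reg f]. The minimum of [cost f] there is no less than
     its value at the incumbent, so the step along [- v0] did not decrease it. *)
  have : dot v0 (al f) <= 0.
    have := ge; rewrite vs lee_fin (J_reg f)// => ge1.
    have := oy.1.2 _ Pq; rewrite qs /cost dotBr dotZr (dotC _ v0) => h.
    rewrite -(pmulr_rle0 _ eps0).
    by move: ge1; rewrite /cost; lra.
  by move=> h1 h2; apply: v00; apply: dot_eq0; exact: le_trans h2 h1.
rewrite /rank (_ : improving s' = improving s); last first.
  by apply/setP => g; rewrite !inE vs'.
rewrite ltn_add2l; apply: proper_card; apply/properP; split.
  apply/fintype.subsetP => g /unseenP ng; apply/unseenP => sg.
  by apply: ng; rewrite cs'; left.
exists f; first exact/unseenP.
by apply/unseenP; apply; rewrite cs'; right.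
Qed.

Let iteration_next r1 r2 v s s' : invariant s -> iter r1 r2 v s s' -> v <> 0 ->
  invariant s'.
Proof.
move=> inv it v0; have [[A [cs' aft]] _] := iteration_invariant _ _ _ _ _ inv it.
by exists A; split=> //; right; exists v.
Qed.

Let initial_invariant y0 s : Y y0 -> initial y0 s -> invariant s.
Proof.
move=> Yy [q v c]; exists finset.set0; split; last by left; split=> //; rewrite q.
by rewrite c; apply/seteqP; split=> // z [g /=]; rewrite inE.
Qed.

Let reachable_invariant y0 s : Y y0 -> reachable Y c1 c2 eps y0 s -> invariant s.
Proof.
move=> Yy; elim=> [s'|s1 r1 r2 v s' _]; first exact: initial_invariant.
exact: iteration_next.
Qed.

Lemma exploration_never_stuck y0 : Y y0 -> never_stuck Y c1 c2 eps y0.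
Proof.
move=> Yy s /(reachable_invariant _ _ Yy) inv; split; first exact: invariant_query.
move=> r1 r2 q1 q2; pose f : F := (r1, r2).
have [yopt oy] : exists z, opt f z by apply: opt_exists; exists (query s).
have [A [cs _]] := inv.
have [lt|ge] := boolP ((cost f yopt)%:E < value s)%E.
  have [v mv] := min_norm_ex [set f]%SET yopt f (set11 f).
  exists v, (State (yopt - eps *: v) yopt (cost f yopt)%:E [set al f]).
  split=> //; first by exists yopt => //=; rewrite -/(al f) -/(be f) -/(cost f yopt) lt.
  by rewrite /= -slopes1.
have [v mv] := min_norm_ex (f |: A)%SET (incumbent s) f (setU11 f A).
exists v, (State (incumbent s - eps *: v) (incumbent s) (value s)
  (cuts s `|` [set al f])).
split=> //.
  by exists yopt => //=; rewrite -/(al f) -/(be f) -/(cost f yopt) (negbTE ge).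
by rewrite /= cs -slopesU1.
Qed.

Lemma exploration_terminates y0 : Y y0 -> no_infinite_execution Y c1 c2 eps y0.
Proof.
move=> Yy [s [r1 [r2 [v [s0 it]]]]].
have inv k : invariant (s k).
  elim: k => [|k inv]; first exact: initial_invariant s0.
  by have [ik vk] := it k; exact: iteration_next ik vk.
have dec k : (rank (s k) + k <= rank (s 0%N))%N.
  elim: k => [|k IH]; first by rewrite addn0.
  apply: leq_trans IH; rewrite addnS -addSn leq_add2r.
  by have [ik _] := it k; have [_] := iteration_invariant _ _ _ _ _ (inv k) ik.
by have := dec (rank (s 0%N)).+1; rewrite addnS ltnNge leq_addl.
Qed.

(** With minimum-norm element 0, some [d] in the hull of the cuts has [- d] normal to [Y] at the
    incumbent. As [d] is a subgradient there, this is the first-order optimality condition. *)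
Lemma exploration_optimal y0 y : Y y0 -> output Y c1 c2 eps y0 y -> minimizer J Y y.
Proof.
move=> Yy [s [r1 [r2 [s' [/(reachable_invariant _ _ Yy) inv it ->]]]]].
have [[A [_ [f [of_ _ rA mv _]]]] _] := iteration_invariant _ _ _ _ _ inv it.
split=> [|z Yz]; first by apply: regY; exact: of_.1.1.
have [[d hd [n Nn dn]] _] := mv.
(* The subgradient inequality at a fixed [z] defines a convex set of slopes; it holds for each cut,
   hence on their convex hull. *)
pose G := [set d | J (incumbent s') + dot d (z - incumbent s') <= J z].
have Gd : G d.
  apply: hd; split=> [|_ [g gA <-]].
    apply/convex_setE => t a b Ga Gb /andP[t0 t1]; rewrite /G/= dotDl !dotZl.
    have h1 : 0 <= t * (J z - (J (incumbent s') + dot a (z - incumbent s'))).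
      by rewrite mulr_ge0// subr_ge0.
    have h2 : 0 <= (1 - t) * (J z - (J (incumbent s') + dot b (z - incumbent s'))).
      by rewrite mulr_ge0// subr_ge0.
    by lra.
  have := cost_le g _ Yz; rewrite /G/= (J_reg _ _ (rA _ gA)) /cost dotBr; lra.
have := Nn _ Yz; have -> : n = - d by apply/eqP; rewrite -addr_eq0 addrC dn.
by rewrite dotNl oppr_le0 => h; apply: le_trans Gd; rewrite lerDl.
Qed.

End Exploration.

(** * The tie-line polyhedron and the conclusion *)

Lemma affine_usubmx (R : realFieldType) (V : lmodType R) m1 m2
    (f : V -> 'cV[R]_(m1 + m2)) : affine_map f -> affine_map (fun x => usubmx (f x)).
Proof. by move=> af t x y; rewrite af; apply/matrixP => i j; rewrite !mxE. Qed.

Lemma affine_dsubmx (R : realFieldType) (V : lmodType R) m1 m2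
    (f : V -> 'cV[R]_(m1 + m2)) : affine_map f -> affine_map (fun x => dsubmx (f x)).
Proof. by move=> af t x y; rewrite af; apply/matrixP => i j; rewrite !mxE. Qed.

Lemma Yset_polyhedron (R : realType) (nb1 nb2 l12 : nat) (t : tieline R nb1 nb2 l12) :
  polyhedron (Yset t).
Proof.
rewrite (_ : Yset t =
  [set y | vle (H_12 t *m usubmx y + H_21 t *m dsubmx y) (f_12 t)] `&`
  [set y | usubmx y (slack t) 0 = 0] `&` ([set y | vle (y_min t) y] `&`
  [set y | vle y (y_max t)])); last first.
  by apply/seteqP; split=> [y []//|y [[? ?] [? ?]]]; split.
have au := affine_usubmx _ _ nb1 nb2 _ (affine_id R 'cV[R]_(nb1 + nb2)).
have ad := affine_dsubmx _ _ nb1 nb2 _ (affine_id R 'cV[R]_(nb1 + nb2)).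
apply: polyhedronI; apply: polyhedronI.
- by apply: polyhedron_coord_le; [apply: affine_add; exact: affine_mulmx|affine].
- by apply: polyhedron_eq; [exact: affine_coord|exact: affine_cst].
- by apply: polyhedron_coord_le; affine.
- by apply: polyhedron_coord_le; affine.
Qed.

Theorem theorem1 (R : realType) (n1 n2 nb1 nb2 l1 l2 l12 : nat)
    (a1 : area R n1 nb1 nb2 l1) (a2 : area R n2 nb2 nb1 l2)
    (t : tieline R nb1 nb2 l12)
    (xi1 : scenario R n1) (xi2 : scenario R n2)
    (c1 c2 : regions R (nb1 + nb2))
    (Y_nonempty : Yset t !=set0)
    (feas1 : forall y, Yset t y -> feasible1 a1 xi1 y !=set0)
    (feas2 : forall y, Yset t y -> feasible2 a2 xi2 y !=set0)
    (crit1 : critical_regions (Yset t) (J1 a1 xi1) c1)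
    (crit2 : critical_regions (Yset t) (J2 a2 xi2) c2) :
  exists eps0 : R, 0 < eps0 /\
    forall eps : R, 0 < eps -> eps < eps0 ->
    forall y0, Yset t y0 ->
      [/\ never_stuck (Yset t) c1 c2 eps y0,
          no_infinite_execution (Yset t) c1 c2 eps y0 &
          forall y, output (Yset t) c1 c2 eps y0 y ->
            minimizer (fun z => J1 a1 xi1 z + J2 a2 xi2 z) (Yset t) y].
Proof.
have cvx1 s y z : Yset t y -> Yset t z -> 0 <= s <= 1 ->
    J1 a1 xi1 (y + s *: (z - y)) <= J1 a1 xi1 y + s * (J1 a1 xi1 z - J1 a1 xi1 y).
  move=> /feas1 fy /feas1 fz s01.
  rewrite /J1 (affine_usubmx _ _ _ _ id) ?(affine_dsubmx _ _ _ _ id)//.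
  exact: opt_cost_convex.
have cvx2 s y z : Yset t y -> Yset t z -> 0 <= s <= 1 ->
    J2 a2 xi2 (y + s *: (z - y)) <= J2 a2 xi2 y + s * (J2 a2 xi2 z - J2 a2 xi2 y).
  move=> /feas2 fy /feas2 fz s01.
  rewrite /J2 (affine_usubmx _ _ _ _ id) ?(affine_dsubmx _ _ _ _ id)//.
  exact: opt_cost_convex.
have pY := Yset_polyhedron _ _ _ _ t.
have [e [e0 he]] := exploration_threshold (Yset t) c1 c2 _ _ pY crit1 crit2.
exists e; split=> // eps eps0 epse y0 Yy0; have good := he _ eps0 epse.
split.
- by apply: exploration_never_stuck; eassumption.
- by apply: exploration_terminates; eassumption.
- by move=> y; apply: exploration_optimal; eassumption.
Qed.
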